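(* There is a dynamic-programming algorithm that, given an alphabet $C$ of $n$ characters with frequencies, a blocking scheme, and a permitted code length $\mathcal{L}$, solves the problem $\mathrm{DOPT}(\mathcal{L})$ exactly, i.e. outputs a prefix tree $T$ with $\mathrm{len}(T)\le \mathcal{L}$ minimizing $\Delta(T)$ among all such prefix trees, in time $O(n^3\cdot \mathcal{L})$.
   Context: Let $C$ be an alphabet of $n$ characters, each $c\in C$ with a nonnegative integer frequency $\mathrm{freq}(c)$. A prefix tree for $C$ is a rooted binary tree in which every internal node has exactly two children and whose leaves are in bijection with $C$; $d_T(c)$ is the depth of the leaf of $c$ (root has depth $0$), i.e. the codeword length of $c$. The code length of $T$ is $\mathrm{len}(T)=\sum_{c\in C}\mathrm{freq}(c)\, d_T(c)$. A blocking scheme is a sequence $\langle (w_1,q_1),(w_2,q_2),\dots\rangle$ of positive integer widths $w_j$ and access costs $q_j\ge 0$ (assumed long enough that the quantities below exist). For a character $c$, let $W_T(c)$ be the smallest $h$ with $\sum_{j=1}^h w_j\ge d_T(c)$, and let $\Delta_T(c)=\sum_{i\le W_T(c)} q_i$. The decode time of $T$ is $\Delta(T)=\sum_{c\in C}\mathrm{freq}(c)\,\Delta_T(c)$. The problem $\mathrm{DOPT}(\mathcal{L})$: given the blocking scheme and $\mathcal{L}$, find a prefix tree $T$ minimizing $\Delta(T)$ subject to $\mathrm{len}(T)\le\mathcal{L}$; $\mathrm{DOPT}(\mathcal{L})$ also denotes the optimal decode time. *)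

(* Defs.v *)
From mathcomp Require Import all_boot all_order all_algebra.

Set Implicit Arguments.
Unset Strict Implicit.
Unset Printing Implicit Defensive.

Import Order.TTheory GRing.Theory Num.Theory.

(** * Prefix trees, blocking schemes, code length and decode time *)

Inductive tree (C : Type) : Type :=
| Leaf of C
| Node of tree C & tree C.

Fixpoint leaves (C : Type) (T : tree C) : seq C :=
  match T with
  | Leaf c => [:: c]
  | Node l r => leaves l ++ leaves r
  end.

Definition prefix_tree (C : finType) (T : tree C) : Prop :=
  perm_eq (leaves T) (enum C).

(* Meaningful when c labels exactly one leaf of T, as it does in a prefix
   tree. *)
Fixpoint depth (C : eqType) (T : tree C) (c : C) : nat :=
  match T with
  | Leaf _ => 0
  | Node l r => (if c \in leaves l then depth l c else depth r c).+1
  end.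

Definition len (C : finType) (freq : C -> nat) (T : tree C) : nat :=
  \sum_(c : C) freq c * depth T c.

(* The j-th pair (from 0) is (w_{j+1}, q_{j+1}).  Integer, rational and real
   access costs are all instances of an ordered domain R. *)
Definition blocking_scheme (R : realDomainType) (B : seq (nat * R)) : Prop :=
  forall p : nat * R, p \in B -> 0 < p.1 /\ (0 <= p.2)%R.

Definition width (R : realDomainType) (B : seq (nat * R)) (h : nat) : nat :=
  \sum_(p <- take h B) p.1.

Definition access (R : realDomainType) (B : seq (nat * R)) (h : nat) : R :=
  (\sum_(p <- take h B) p.2)%R.

(* The scheme is long enough for every W_T(c) to exist. *)
Definition long_enough (C : finType) (R : realDomainType)
    (B : seq (nat * R)) : Prop :=
  forall (T : tree C) (c : C), prefix_tree T ->
    exists2 h : nat, h <= size B & depth T c <= width B h.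

(* W_T(c) for a character at depth d: the least h <= size B such that
   d <= width B h, if there is one. *)
Definition blocks (R : realDomainType) (B : seq (nat * R)) (d : nat) : nat :=
  find (fun h => d <= width B h) (iota 0 (size B).+1).

Definition char_decode_time (C : finType) (R : realDomainType)
    (B : seq (nat * R)) (T : tree C) (c : C) : R :=
  access B (blocks B (depth T c)).

Definition decode_time (C : finType) (R : realDomainType) (freq : C -> nat)
    (B : seq (nat * R)) (T : tree C) : R :=
  (\sum_(c : C) (freq c)%:R * char_decode_time B T c)%R.

Definition feasible (C : finType) (freq : C -> nat) (L : nat)
    (T : tree C) : Prop :=
  prefix_tree T /\ len freq T <= L.

Definition DOPT_solution (C : finType) (R : realDomainType) (freq : C -> nat)
    (B : seq (nat * R)) (L : nat) (T : tree C) : Prop :=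
  feasible freq L T /\
  forall T' : tree C, feasible freq L T' ->
    (decode_time freq B T <= decode_time freq B T')%R.

(** * Machine model

  A uniform-cost random access machine, presented as a while language over
  arrays.  Array names are natural numbers; a cell is given by an array name
  and a list of indices, and a scalar is the cell with the empty list.  There
  are integer arrays and, for access costs, arrays over R.  The integer
  operations are addition, truncated subtraction and comparison; the
  operations on R are addition, subtraction, multiplication by an integer and
  comparison.  Programs are pure syntax: they cannot mention elements of R, and
  one program handles inputs of every size.  Every syntactic node that is
  evaluated costs one step. *)

Inductive nexp : Type :=
| NConst of nat
| NGet of nat & seq nexp
| NAdd of nexp & nexp
| NSub of nexp & nexp.

Inductive rexp : Type :=
| RGet of nat & seq nexp
| RAdd of rexp & rexp
| RSub of rexp & rexp
| RScale of nexp & rexp.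

Inductive bexp : Type :=
| BLe of nexp & nexp
| BEq of nexp & nexp
| BLeR of rexp & rexp
| BNot of bexp
| BAnd of bexp & bexp.

Inductive cmd : Type :=
| Skip
| NSet of nat & seq nexp & nexp
| RSet of nat & seq nexp & rexp
| Seq of cmd & cmd
| If of bexp & cmd & cmd
| While of bexp & cmd.

Record state (R : Type) : Type := State {
  nmem : nat -> seq nat -> nat;
  rmem : nat -> seq nat -> R
}.

Definition upd (V : Type) (m : nat -> seq nat -> V) (a : nat) (i : seq nat)
    (v : V) : nat -> seq nat -> V :=
  fun a' i' => if (a' == a) && (i' == i) then v else m a' i'.

Fixpoint neval (R : Type) (s : state R) (e : nexp) : nat :=
  match e with
  | NConst k => k
  | NGet a i => nmem s a (map (neval s) i)
  | NAdd e1 e2 => neval s e1 + neval s e2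
  | NSub e1 e2 => neval s e1 - neval s e2
  end.

Fixpoint reval (R : realDomainType) (s : state R) (e : rexp) : R :=
  match e with
  | RGet a i => rmem s a (map (neval s) i)
  | RAdd e1 e2 => (reval s e1 + reval s e2)%R
  | RSub e1 e2 => (reval s e1 - reval s e2)%R
  | RScale k e1 => ((neval s k)%:R * reval s e1)%R
  end.

Fixpoint beval (R : realDomainType) (s : state R) (b : bexp) : bool :=
  match b with
  | BLe e1 e2 => neval s e1 <= neval s e2
  | BEq e1 e2 => neval s e1 == neval s e2
  | BLeR e1 e2 => (reval s e1 <= reval s e2)%R
  | BNot b1 => ~~ beval s b1
  | BAnd b1 b2 => beval s b1 && beval s b2
  end.

Fixpoint ncost (e : nexp) : nat :=
  match e with
  | NConst _ => 1
  | NGet _ i => (sumn (map ncost i)).+1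
  | NAdd e1 e2 | NSub e1 e2 => (ncost e1 + ncost e2).+1
  end.

Fixpoint rcost (e : rexp) : nat :=
  match e with
  | RGet _ i => (sumn (map ncost i)).+1
  | RAdd e1 e2 | RSub e1 e2 => (rcost e1 + rcost e2).+1
  | RScale k e1 => (ncost k + rcost e1).+1
  end.

Fixpoint bcost (b : bexp) : nat :=
  match b with
  | BLe e1 e2 | BEq e1 e2 => (ncost e1 + ncost e2).+1
  | BLeR e1 e2 => (rcost e1 + rcost e2).+1
  | BNot b1 => (bcost b1).+1
  | BAnd b1 b2 => (bcost b1 + bcost b2).+1
  end.

(* [exec P s s' t]: started in s, P halts in s' after t steps. *)
Inductive exec (R : realDomainType) :
    cmd -> state R -> state R -> nat -> Prop :=
| ExecSkip s : exec Skip s s 1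
| ExecNSet a i e s :
    exec (NSet a i e) s
      (State (upd (nmem s) a (map (neval s) i) (neval s e)) (rmem s))
      (sumn (map ncost i) + ncost e).+1
| ExecRSet a i e s :
    exec (RSet a i e) s
      (State (nmem s) (upd (rmem s) a (map (neval s) i) (reval s e)))
      (sumn (map ncost i) + rcost e).+1
| ExecSeq c1 c2 s1 s2 s3 t1 t2 :
    exec c1 s1 s2 t1 -> exec c2 s2 s3 t2 ->
    exec (Seq c1 c2) s1 s3 (t1 + t2)
| ExecIf b c1 c2 s s' t :
    exec (if beval s b then c1 else c2) s s' t ->
    exec (If b c1 c2) s s' (bcost b + t).+1
| ExecWhileDone b c s :
    ~~ beval s b ->
    exec (While b c) s s (bcost b).+1
| ExecWhileStep b c s1 s2 s3 t1 t2 :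
    beval s1 b -> exec c s1 s2 t1 -> exec (While b c) s2 s3 t2 ->
    exec (While b c) s1 s3 (bcost b + t1 + t2).+1.

(** * Input and output conventions *)

(* Integer array 0 holds n, 1 holds the permitted code length, 2 the number of
   blocks, 3 the frequencies, 4 the widths; R-array 0 holds the access costs.
   All other cells are 0. *)
Definition input (R : realDomainType) (n : nat) (freq : 'I_n -> nat)
    (B : seq (nat * R)) (L : nat) : state R :=
  State
    (fun a i =>
       match a, i with
       | 0, [::] => n
       | 1, [::] => L
       | 2, [::] => size B
       | 3, [:: c] => if insub c is Some c' then freq c' else 0
       | 4, [:: j] => nth 0 (map fst B) j
       | _, _ => 0
       end)
    (fun a i =>
       match a, i with
       | 0, [:: j] => nth 0%R (map snd B) j
       | _, _ => 0%R
       end).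

Definition out_status : nat := 5.
Definition out_root : nat := 6.
Definition out_kind : nat := 7.
Definition out_label : nat := 8.
Definition out_left : nat := 9.
Definition out_right : nat := 10.

(* The linked structure with root v is T: a node of kind 0 is a leaf carrying
   its label, one of kind 1 is internal and points to its two children. *)
Fixpoint stores (R : Type) (n : nat) (s : state R) (v : nat)
    (T : tree 'I_n) : Prop :=
  match T with
  | Leaf c => nmem s out_kind [:: v] = 0 /\ nmem s out_label [:: v] = c
  | Node l r =>
      [/\ nmem s out_kind [:: v] = 1,
          stores s (nmem s out_left [:: v]) l
        & stores s (nmem s out_right [:: v]) r]
  end.

(* Status 1 announces a solution, status 0 that no prefix tree respects the
   permitted code length. *)
Definition outputs_DOPT (R : realDomainType) (n : nat) (freq : 'I_n -> nat)
    (B : seq (nat * R)) (L : nat) (s : state R) : Prop :=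
  (nmem s out_status [::] = 1 /\
     exists T : tree 'I_n,
       stores s (nmem s out_root [::]) T /\ DOPT_solution freq B L T)
  \/ (nmem s out_status [::] = 0 /\
        ~ exists T : tree 'I_n, feasible freq L T).

(* Main.v *)
Require Import Defs.
From mathcomp Require Import all_boot all_order all_algebra.
From mathcomp Require Import zify ring.

(** A tree is determined, up to exchanges, by the numbers of leaves on each of
    its levels.  Order the characters by frequency and build the tree downwards,
    keeping the number [k] of levels left, the number [r] of characters left
    (always the [r] least frequent ones), the number [b] of open nodes on the
    current level and the unused code length [l].  Either an open node becomes
    the leaf of the most frequent character left, or every open node is split
    and the next level begins.  An exchange argument shows that these two moves
    suffice, so a table over [(k, r, b, l)] with constant work per entry, hence
    [O(n^3 L)] work in all, contains the optimum; the tree is read back in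
    breadth-first order. *)

Set Implicit Arguments.
Unset Strict Implicit.
Unset Printing Implicit Defensive.

Import Order.TTheory GRing.Theory Num.Theory.

(** * Forests and the dynamic program *)

(** The decode time of a character is a nondecreasing function [D] of its depth, and the optimality
    argument knows nothing more about the blocks. Let a leaf at depth [d] carry [c], while the most
    frequent character left sits at depth [e >= d]. Swapping the two lowers the length by the gap of
    frequencies times [e - d], and the time by the same gap times [D e - D d]. Both amounts are
    nonnegative, so one swap respects the length constraint and the objective together. The four
    indices suffice for these reasons: after sorting, the number [r] alone names the set of
    remaining characters; every open node must receive a character, whence [b <= n]; a tree with [n]
    leaves has height below [n], so [n] levels are enough. A leaf is charged for its whole depth
    when it is placed, so splitting a level costs nothing. The machine has no integer
    multiplication, so the products of depths and frequencies are built beforehand by repeated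
    addition. All phases except the table take at most quadratic time. *)

Section Forests.
Variable C : eqType.
Implicit Types (T : tree C) (F : seq (tree C)).

(** Both costs are sums over this list, so exchanging labels or reordering trees becomes a matter of
    permuting pairs, without the membership tests of [depth]. *)
Fixpoint leaf_depths (d : nat) T : seq (nat * C) :=
  match T with
  | Leaf c => [:: (d, c)]
  | Node l r => leaf_depths d.+1 l ++ leaf_depths d.+1 r
  end.

Fixpoint height T : nat :=
  match T with
  | Leaf _ => 0
  | Node l r => (maxn (height l) (height r)).+1
  end.

Fixpoint relabel (g : C -> C) T : tree C :=
  match T with
  | Leaf c => Leaf (g c)
  | Node l r => Node (relabel g l) (relabel g r)
  end.

Definition is_leaf T : bool := if T is Leaf _ then true else false.

Definition subtrees T : seq (tree C) :=
  if T is Node l r then [:: l; r] else [::].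

Definition forest_depths (d : nat) F : seq (nat * C) :=
  flatten [seq leaf_depths d T | T <- F].

Definition next_level F : seq (tree C) := flatten [seq subtrees T | T <- F].

(** This undoes [next_level] on forests without leaves. An odd tree at the end would be dropped,
    hence the parity condition below. *)
Fixpoint pair_up F : seq (tree C) :=
  if F is l :: r :: F' then Node l r :: pair_up F' else [::].

Lemma leaf_depths_leaves d T : [seq x.2 | x <- leaf_depths d T] = leaves T.
Proof. by elim: T d => //= l IHl r IHr d; rewrite map_cat IHl IHr. Qed.

Lemma leaf_depths_ge d T x : x \in leaf_depths d T -> d <= x.1.
Proof.
elim: T d => [c|l IHl r IHr] d /=; first by rewrite inE => /eqP ->.
by rewrite mem_cat => /orP[/IHl|/IHr] /ltnW.
Qed.

Lemma leaf_depths_relabel g d T :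
  leaf_depths d (relabel g T) = [seq (x.1, g x.2) | x <- leaf_depths d T].
Proof. by elim: T d => //= l IHl r IHr d; rewrite map_cat IHl IHr. Qed.

Lemma height_relabel g T : height (relabel g T) = height T.
Proof. by elim: T => //= l -> r ->. Qed.

Lemma height_lt_leaves T : height T < size (leaves T).
Proof. by elim: T => //= l IHl r IHr; rewrite size_cat; lia. Qed.

Lemma forest_depths_cons d T F :
  forest_depths d (T :: F) = leaf_depths d T ++ forest_depths d F.
Proof. by []. Qed.

Lemma forest_depths_ge d F x : x \in forest_depths d F -> d <= x.1.
Proof.
elim: F => //= T F IH; rewrite forest_depths_cons mem_cat.
by case/orP=> [/leaf_depths_ge|/IH].
Qed.

Lemma forest_depths_relabel g d F :
  forest_depths d [seq relabel g T | T <- F]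
  = [seq (x.1, g x.2) | x <- forest_depths d F].
Proof.
elim: F => //= T F IH.
by rewrite !forest_depths_cons map_cat IH leaf_depths_relabel.
Qed.

Lemma forest_depths_pair_up d F :
  ~~ odd (size F) -> forest_depths d (pair_up F) = forest_depths d.+1 F.
Proof.
have [m] := ubnP (size F); elim: m F => // m IH [|l [|r F]] //= hm.
by rewrite negbK !forest_depths_cons => /IH-> /=; rewrite ?catA //; lia.
Qed.

Lemma size_pair_up F : size (pair_up F) = (size F)./2.
Proof.
have [m] := ubnP (size F); elim: m F => // m IH [|l [|r F]] //= hm.
by rewrite IH //; lia.
Qed.

Lemma nth_pair_up T0 F j : j.*2.+1 < size F ->
  nth T0 (pair_up F) j = Node (nth T0 F j.*2) (nth T0 F j.*2.+1).
Proof.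
by elim: j F => [|j IH] [|l [|r F]] //= h; rewrite IH //; move: h; lia.
Qed.

Lemma forest_depths_next_level d F : ~~ has is_leaf F ->
  forest_depths d F = forest_depths d.+1 (next_level F).
Proof.
elim: F => //= -[c|l r] F IH //= /IH.
by rewrite forest_depths_cons => ->; rewrite /next_level /= !forest_depths_cons catA.
Qed.

Lemma size_next_level F : ~~ has is_leaf F ->
  size (next_level F) = size F + size F.
Proof.
elim: F => //= -[c|l r] F IH //= /IH.
by rewrite /next_level /= => ->; lia.
Qed.

Lemma height_next_level k F : all (fun T => height T < k.+1) F ->
  all (fun T => height T < k) (next_level F).
Proof.
elim: F => // -[c|l r] F IH; first exact: IH.
case/andP=> /= h /IH; rewrite /next_level /= => ->.
by rewrite andbT; lia.
Qed.

Lemma size_forest_depths d F : size F <= size (forest_depths d F).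
Proof.
elim: F => //= T F IH; rewrite forest_depths_cons size_cat.
have := height_lt_leaves T; rewrite -(leaf_depths_leaves d) size_map; lia.
Qed.

(** The abstract summand [h] lets one induction serve the code length and the decode time. Labels
    must be distinct because [depth] goes left as soon as the label occurs there. *)
Lemma depth_leaf_depths (V : nmodType) (h : C -> nat -> V) d T :
  uniq (leaves T) ->
  (\sum_(c <- leaves T) h c (d + depth T c)%N
   = \sum_(x <- leaf_depths d T) h x.2 x.1)%R.
Proof.
elim: T d => [c|l IHl r IHr] d /=; first by rewrite !big_seq1 addn0.
rewrite cat_uniq => /and3P[ul hlr ur].
rewrite !big_cat /= -IHl // -IHr //; congr (_ + _)%R.
  by rewrite !big_seq; apply: eq_bigr => c hc; rewrite hc addSnnS.
rewrite !big_seq; apply: eq_bigr => c hc; case: ifP => hcl; last by rewrite addSnnS.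
by move/hasPn: hlr => /(_ c hc); rewrite /= hcl.
Qed.

End Forests.

(** * The recurrence, its soundness and its optimality *)

Section DynamicProgram.
Variables (R : realDomainType) (C : eqType) (freq : C -> nat) (D : nat -> R).
Variables (n : nat) (g : nat -> C).
Implicit Types (F : seq (tree C)).

Local Notation fs r := (freq (g r)).

(* The first component of an entry is 0 if the state is infeasible, 1 if a leaf
   should be placed and 2 if the level should be split; the second component,
   meaningful in the last two cases, is the least decode time of the part of the
   tree still to be built.  With [k] levels left the current depth is [n - k]. *)
Definition leaf_option (k r : nat) (prev : nat -> nat * R) (l : nat) : nat * R :=
  let cl := (n - k.+1) * fs r in
  if (cl <= l) && (0 < (prev (l - cl)).1)
  then (1, ((prev (l - cl)%N).2 + (fs r)%:R * D (n - k.+1)%N)%R) else (0, 0%R).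

Definition better (x y : nat * R) : nat * R :=
  if (0 < y.1) && ((x.1 == 0) || ~~ (x.2 <= y.2)%R) then (2, y.2) else x.

(** Two nested structural recursions: a leaf lowers [r] within a level, a split passes to the lower
    level [below] and doubles [b]. *)
Fixpoint row (below : nat -> nat -> nat -> nat * R) (k r b l : nat) : nat * R :=
  match r, b with
  | 0, 0 => (1, 0%R)
  | r'.+1, b'.+1 =>
      better (leaf_option k r' (row below k r' b') l) (below r (b + b) l)
  | _, _ => (0, 0%R)
  end.

(** The cut at [b <= n] loses no solution, since each open node ends up holding at least one of at
    most [n] characters; it bounds the table although splitting doubles [b]. *)
Fixpoint tab (k r b l : nat) : nat * R :=
  if k is k'.+1 then
    if b <= n then row (tab k') k' r b l else (0, 0%R)
  else (0, 0%R).

Fixpoint row_forest (below : nat -> nat -> nat -> seq (tree C))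
    (k r b l : nat) : seq (tree C) :=
  match r, b with
  | r'.+1, b'.+1 =>
      if (tab k.+1 r b l).1 == 1
      then Leaf (g r') :: row_forest below k r' b' (l - (n - k.+1) * fs r')
      else pair_up (below r (b + b) l)
  | _, _ => [::]
  end.

Fixpoint best_forest (k r b l : nat) : seq (tree C) :=
  if k is k'.+1 then row_forest (best_forest k') k' r b l else [::].

Lemma tab_small k r b l : n < b -> tab k r b l = (0, 0%R).
Proof. by case: k => //= k; rewrite ltnNge => /negbTE ->. Qed.

Lemma tabSS k r b l : b < n ->
  tab k.+1 r.+1 b.+1 l
  = better (leaf_option k r (tab k.+1 r b) l) (tab k r.+1 (b.+1 + b.+1) l).
Proof. by move=> hb; rewrite /= hb ltnW. Qed.

(** A feasible entry points to a feasible entry, so reading the tree back never gets stuck. *)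
Lemma tab_step k r b l : 0 < (tab k.+1 r.+1 b.+1 l).1 ->
  if (tab k.+1 r.+1 b.+1 l).1 == 1
  then 0 < (tab k.+1 r b (l - (n - k.+1) * fs r)).1
  else 0 < (tab k r.+1 (b.+1 + b.+1) l).1.
Proof.
have [hb|hb] := ltnP b n; last by rewrite tab_small.
rewrite tabSS // /better; case: ifP => [/andP[]//|_].
by rewrite /leaf_option; case: ifP => // /andP[].
Qed.

Lemma best_forestSS k r b l :
  best_forest k.+1 r.+1 b.+1 l =
  if (tab k.+1 r.+1 b.+1 l).1 == 1
  then Leaf (g r) :: best_forest k.+1 r b (l - (n - k.+1) * fs r)
  else pair_up (best_forest k r.+1 (b.+1 + b.+1) l).
Proof. by []. Qed.

Definition forest_len (d : nat) F : nat :=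
  \sum_(x <- forest_depths d F) freq x.2 * x.1.

Definition forest_time (d : nat) F : R :=
  (\sum_(x <- forest_depths d F) (freq x.2)%:R * D x.1)%R.

(** Soundness: every table value is attained by an actual forest. That no forest does better is
    [tab_optimal]. *)
Lemma best_forest_correct k r b l : 0 < (tab k r b l).1 -> k <= n ->
  let F := best_forest k r b l in
  [/\ size F = b,
      perm_eq [seq x.2 | x <- forest_depths (n - k) F] (mkseq g r),
      forest_len (n - k) F <= l
    & forest_time (n - k) F = (tab k r b l).2].
Proof.
elim: k r b l => // k IHk r; elim: r => [|r IHr] b l.
  case: b => [|b] /=; last by case: ifP.
  by move=> _ _; rewrite /forest_len /forest_time big_nil; split; rewrite ?big_nil.
case: b => [|b]; first by rewrite /=.
have [hb|hb] := ltnP b n; last by rewrite tab_small.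
move=> htab hk; have := htab; rewrite tabSS //.
set A := leaf_option _ _ _ _; set Bo := tab k r.+1 _ l.
have eqF : best_forest k.+1 r.+1 b.+1 l =
    if (better A Bo).1 == 1
    then Leaf (g r) :: best_forest k.+1 r b (l - (n - k.+1) * fs r)
    else pair_up (best_forest k r.+1 (b.+1 + b.+1) l) by rewrite /A /Bo -tabSS.
rewrite /= in eqF; rewrite /best_forest -/best_forest /= {}eqF.
rewrite {}/better; case: ifP => /= [/andP[hB _] _|_ hA].
  have [hs hp hl ht] := IHk _ _ _ hB (ltnW hk).
  (* The lower forest has [b.+1 + b.+1] trees, so pairing them up drops none. *)
  have hodd : ~~ odd (size (best_forest k r.+1 (b.+1 + b.+1) l)) by rewrite hs; lia.
  rewrite /forest_len /forest_time forest_depths_pair_up // size_pair_up hs.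
  by rewrite subnSK //; split => //; lia.
move: hA; rewrite {}/A /leaf_option; case: ifP => //= /andP[hcl hprev] _.
have [hs hp hl ht] := IHr _ _ hprev hk.
move: hs hp hl ht; rewrite /forest_len /forest_time /=.
set F := row_forest _ _ _ _ _ => hs hp hl ht; rewrite hs; split => //.
- by rewrite mkseqS -cats1 perm_sym perm_catC /= perm_cons perm_sym.
- by rewrite forest_depths_cons big_cons /=; move: hl; lia.
- by rewrite forest_depths_cons big_cons /= -/forest_depths ht addrC.
Qed.

Hypothesis D_mono : forall d e, d <= e -> (D d <= D e)%R.
Hypothesis g_sorted : forall r r', r <= r' -> r' < n -> fs r <= fs r'.
Hypothesis g_inj : {in [pred r | r < n] &, injective g}.

Lemma le_better (x y : nat * R) v :
  (0 < x.1) && (x.2 <= v)%R || (0 < y.1) && (y.2 <= v)%R ->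
  (0 < (better x y).1) && ((better x y).2 <= v)%R.
Proof.
case: x => [x1 x2]; case: y => [y1 y2]; rewrite /better /=.
case: y1 => [|y1] /=; first by rewrite orbF.
case: x1 => [|x1] //=.
have [h|h] /= := leP x2 y2 => /orP[] // h'.
- exact: le_trans h'.
- exact: le_trans (ltW h) h'.
Qed.

(** Here [c] labels a leaf at depth [d] outside [F], and every leaf of [F] is at depth [d] or more.
    Giving [g r] the shallow place and renaming its old leaf to [c] moves the more frequent
    character upwards. *)
Lemma label_exchange d c F r : r < n ->
  perm_eq (c :: [seq x.2 | x <- forest_depths d F]) (mkseq g r.+1) ->
  exists h : C -> C, let F' := [seq relabel h T | T <- F] in
  [/\ perm_eq [seq x.2 | x <- forest_depths d F'] (mkseq g r),
      forest_len d F' + fs r * d <= forest_len d F + freq c * d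
    & (forest_time d F' + (fs r)%:R * D d
       <= forest_time d F + (freq c)%:R * D d)%R].
Proof.
move=> hr hp; have hc : c \in mkseq g r.+1 by rewrite -(perm_mem hp) mem_head.
have fc : freq c <= fs r.
  case/mapP: hc => i; rewrite mem_iota => /andP[_ hi] ->.
  by apply: g_sorted => //; lia.
have hp' : perm_eq (c :: [seq x.2 | x <- forest_depths d F]) (g r :: mkseq g r).
  by apply: perm_trans hp _; rewrite mkseqS -cats1 perm_catC.
have [ec|nc] := eqVneq c (g r).
  exists id => /=; rewrite -ec /forest_len /forest_time forest_depths_relabel /=.
  rewrite (eq_map (g := id)) ?map_id; last by case.
  by split => //; move: hp'; rewrite -ec perm_cons.
exists (fun x => if x == g r then c else x) => /=.
rewrite /forest_len /forest_time forest_depths_relabel.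
have : g r \in [seq x.2 | x <- forest_depths d F].
  have := perm_mem hp' (g r); rewrite mem_head inE eq_sym (negbTE nc) /=.
  by move->.
case/mapP=> -[e x] he /= ex; subst x; have /= hde := forest_depths_ge he.
set X := forest_depths d F in hp' he *.
have hX := perm_to_rem he; set Y := rem _ X in hX.
have hpY : perm_eq (c :: [seq x.2 | x <- Y]) (mkseq g r).
  rewrite -(perm_cons (g r)) -(permPr hp').
  rewrite perm_sym (permPl (_ : perm_eq _ (c :: g r :: [seq x.2 | x <- Y]))).
    by rewrite -(cat1s c) -(cat1s (g r)) perm_catCA.
  by rewrite perm_cons; apply: (perm_map snd hX).
(* By injectivity of [g], the character [g r] has a single occurrence; hence the renaming fixes the
   remaining pairs [Y]. *)
have grY : g r \notin [seq x.2 | x <- Y].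
  apply/negP=> h; have : g r \in mkseq g r by rewrite -(perm_mem hpY) inE h orbT.
  case/mapP=> i; rewrite mem_iota => /andP[_ hi] /g_inj; rewrite !inE => h'.
  by have := h' hr ltac:(lia); lia.
have eY : [seq (x.1, if x.2 == g r then c else x.2) | x <- Y] = Y.
  rewrite -[RHS]map_id; apply/eq_in_map => -[u v] huv /=.
  case: eqP => // ev; case/negP: grY; rewrite -ev.
  by apply/mapP; exists (u, v).
have hX' := perm_map (fun x => (x.1, if x.2 == g r then c else x.2)) hX.
rewrite /= eqxx eY in hX'.
split.
- by rewrite -(permPr hpY) (perm_map snd hX').
- rewrite (perm_big _ hX') (perm_big _ hX) /= !big_cons /=.
  (* With the larger frequency and the larger depth written as the smaller one plus a gap, the two
     sides differ by the product of the gaps. *)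
  by rewrite -(subnKC fc) -(subnKC hde) /= !(mulnDl, mulnDr); lia.
- rewrite (perm_big _ hX') (perm_big _ hX) /= !big_cons /= -subr_ge0.
  set S := (\sum_(j <- Y) _)%R.
  have -> : ((fs r)%:R * D e + S + (freq c)%:R * D d
     - ((freq c)%:R * D e + S + (fs r)%:R * D d)
     = ((fs r)%:R - (freq c)%:R) * (D e - D d))%R by ring.
  by rewrite mulr_ge0 ?subr_ge0 ?ler_nat ?D_mono.
Qed.

Lemma has_leaf_split F : has (@is_leaf C) F ->
  exists F1 c F2, F = F1 ++ Leaf c :: F2.
Proof.
elim: F => //= -[c|l r'] F IH /=; first by exists [::], c, F.
by case/IH=> F1 [c [F2 ->]]; exists (Node l r' :: F1), c, F2.
Qed.

Lemma forest_depths_cat d F1 F2 :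
  forest_depths d (F1 ++ F2) = forest_depths d F1 ++ forest_depths d F2.
Proof. by rewrite /forest_depths map_cat flatten_cat. Qed.

(* If some tree of the forest is a single leaf, exchanging its label with the
   most frequent remaining character increases neither cost; otherwise the
   whole level can be split. *)
Lemma tab_optimal k r b l F : 0 < k <= n -> r <= n ->
  size F = b -> perm_eq [seq x.2 | x <- forest_depths (n - k) F] (mkseq g r) ->
  all (fun T => height T < k) F -> forest_len (n - k) F <= l ->
  (0 < (tab k r b l).1) && ((tab k r b l).2 <= forest_time (n - k)%N F)%R.
Proof.
elim: k r b l F => // k IHk r; elim: r => [|r IHr] b l F hk hr hsz hp hh hl.
  have := size_forest_depths (n - k.+1) F; have := perm_size hp.
  rewrite size_map => /= -> /=; rewrite leqn0 => /nilP eF; subst F.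
  by rewrite -hsz /= /forest_time big_nil.
(* Each tree has at least one leaf, so a forest carrying [r.+1 <= n] characters stays within the cut
   at [b <= n]. *)
have hbr : size F <= r.+1.
  rewrite -(size_mkseq g r.+1) -(perm_size hp) size_map.
  exact: size_forest_depths.
case: F hsz hp hh hl hbr => [|T F]; first by move=> _ /perm_size; rewrite size_mkseq.
move=> <- hp hh hl hbr; set G := T :: F in hp hh hl hbr *.
rewrite /= in hbr; rewrite tabSS ?(leq_trans hbr hr) //; apply: le_better.
have [hleaf|hnl] := boolP (has (@is_leaf C) G); apply/orP; [left|right].
  have [F1 [c [F2 eG]]] := has_leaf_split hleaf.
  have hpG : perm_eq (forest_depths (n - k.+1) G)
      ((n - k.+1, c) :: forest_depths (n - k.+1) (F1 ++ F2)).
    rewrite eG !forest_depths_cat forest_depths_cons /=.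
    by rewrite -cat1s perm_catCA.
  have hp1 : perm_eq
      (c :: [seq x.2 | x <- forest_depths (n - k.+1) (F1 ++ F2)]) (mkseq g r.+1).
    by rewrite -(permPl (perm_map snd hpG)).
  have [h [hp2 hl2 ht2]] := label_exchange hr hp1.
  move: hl; rewrite /forest_len (perm_big _ hpG) big_cons /= => hl.
  rewrite /forest_time (perm_big _ hpG) big_cons /=.
  set F' := [seq relabel h T | T <- F1 ++ F2] in hp2 hl2 ht2.
  have hsF : size F' = size F.
    have := congr1 size eG; rewrite /F' size_map !size_cat /=; lia.
  have hh' : all (fun T => height T < k.+1) F'.
    rewrite all_map; apply: sub_all (_ : all (fun T => height T < k.+1) _) => [T' /=|].
      by rewrite height_relabel.
    by move: hh; rewrite eG !all_cat /=.
  rewrite /forest_len /forest_time in hl2 ht2.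
  have hl3 : forest_len (n - k.+1) F' <= l - (n - k.+1) * fs r.
    by rewrite /forest_len; move: hl hl2; lia.
  have /andP[h1 h2] := IHr _ _ _ hk (ltnW hr) hsF hp2 hh' hl3.
  have hcl : (n - k.+1) * fs r <= l.
    by move: hl hl2; clear; move: (n - k.+1) => d; lia.
  rewrite /leaf_option hcl h1; apply/andP; split=> //.
  by apply: le_trans (lerD h2 (lexx _)) (le_trans ht2 _); rewrite addrC.
(* The first tree is not a leaf, so its positive height leaves room for another level. *)
have hk' : 0 < k.
  by move: hh hnl; rewrite /G /=; case: (T) => //= l' r' /andP[h _] _; lia.
rewrite forest_depths_next_level // in hp; rewrite /forest_len forest_depths_next_level // in hl.
rewrite /forest_time forest_depths_next_level //.
rewrite subnSK in hp hl *; last by lia.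
by apply: IHk => //; [lia|rewrite size_next_level|exact: height_next_level].
Qed.
End DynamicProgram.

(** * Blocking schemes, sorting and solutions *)

Section Blocking.
Variables (R : realDomainType) (B : seq (nat * R)).
Hypothesis B_scheme : blocking_scheme B.

Lemma widthS h : h < size B -> width B h.+1 = width B h + nth 0 (map fst B) h.
Proof.
case: B => [|p0 B'] // hh.
by rewrite /width (take_nth p0) // -cats1 big_cat big_seq1 (nth_map p0).
Qed.

Lemma accessS h : h < size B ->
  access B h.+1 = (access B h + nth 0 (map snd B) h)%R.
Proof.
case: B => [|p0 B'] // hh.
by rewrite /access (take_nth p0) // -cats1 big_cat big_seq1 (nth_map p0).
Qed.

Lemma width_gt0 h : h < size B -> 0 < nth 0 (map fst B) h.
Proof.
case: B B_scheme => [|p0 B'] // hB hh; rewrite (nth_map p0) //.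
by have [] := hB _ (mem_nth p0 hh).
Qed.

Lemma access_ge0 h : (0 <= nth 0 (map snd B) h)%R.
Proof.
have [hh|hh] := ltnP h (size B); last by rewrite nth_default ?size_map.
case: B B_scheme hh => [|p0 B'] // hB hh; rewrite (nth_map p0) //.
by have [] := hB _ (mem_nth p0 hh).
Qed.

Lemma width_mono h h' : h <= h' -> width B h <= width B h'.
Proof.
elim: h' => [|h' IH]; first by rewrite leqn0 => /eqP ->.
rewrite leq_eqVlt => /orP[/eqP -> //|/IH hh]; apply: leq_trans hh _.
have [hs|hs] := ltnP h' (size B); first by rewrite widthS // leq_addr.
by rewrite /width !take_oversize // ltnW.
Qed.

Lemma access_mono h h' : h <= h' -> (access B h <= access B h')%R.
Proof.
elim: h' => [|h' IH]; first by rewrite leqn0 => /eqP ->.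
rewrite leq_eqVlt => /orP[/eqP -> //|/IH hh]; apply: le_trans hh _.
have [hs|hs] := ltnP h' (size B); first by rewrite accessS // lerDl access_ge0.
by rewrite /access !take_oversize // ltnW.
Qed.

Lemma blocks_unique d h : h <= size B -> d <= width B h ->
  (forall h', h' < h -> width B h' < d) -> blocks B d = h.
Proof.
move=> hs hd hlt; rewrite /blocks; set a := fun _ => _.
have hnth i : i <= size B -> nth 0 (iota 0 (size B).+1) i = i.
  by move=> hi; rewrite nth_iota.
have hha : has a (iota 0 (size B).+1).
  by apply/hasP; exists h; rewrite ?mem_iota.
have := nth_find 0 hha; have := hha; rewrite has_find size_iota ltnS => hf.
rewrite hnth // /a => hw; apply/eqP; rewrite eqn_leq; apply/andP; split.
  rewrite leqNgt; apply/negP => /(before_find 0).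
  by rewrite hnth // hd.
by rewrite leqNgt; apply/negP => /hlt; rewrite ltnNge hw.
Qed.

Lemma blocks0 : blocks B 0 = 0.
Proof. exact: blocks_unique. Qed.

Lemma blocks_le d h : h <= size B -> d <= width B h -> blocks B d <= h.
Proof.
move=> hs hd; rewrite /blocks leqNgt; apply/negP => /(before_find 0).
by rewrite nth_iota ?ltnS // hd.
Qed.

Lemma blocks_mono d e : d <= e -> blocks B d <= blocks B e.
Proof.
move=> hde; rewrite /blocks; apply: sub_find => h /=; exact: leq_trans.
Qed.

Section Reached.
Variable d : nat.
Hypothesis reached : d <= width B (size B).

Lemma width_blocks : d <= width B (blocks B d).
Proof.
have hha : has (fun h => d <= width B h) (iota 0 (size B).+1).
  by apply/hasP; exists (size B); rewrite ?mem_iota ?ltnSn.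
have := nth_find 0 hha; rewrite -/(blocks B d).
by move: hha; rewrite has_find size_iota => h; rewrite nth_iota.
Qed.

Lemma width_lt_blocks h : h < blocks B d -> width B h < d.
Proof.
move=> hh; rewrite ltnNge; apply/negP=> hd.
have hs : blocks B d <= size B by apply: blocks_le.
by have := blocks_le (leq_trans (ltnW hh) hs) hd; rewrite leqNgt hh.
Qed.
End Reached.

Lemma blocks_lt_size d : d < width B (size B) -> width B (blocks B d) <= d ->
  blocks B d < size B.
Proof.
move=> hd hw; have := blocks_le (leqnn _) (ltnW hd).
by rewrite leq_eqVlt => /orP[/eqP e|//]; move: hd; rewrite -{1}e ltnNge hw.
Qed.

(** Widths are positive, so going one level deeper opens at most one more block. This allows all
    decode times to be tabulated in linear time, whatever the number of blocks. *)
Lemma blocksS d : d < width B (size B) ->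
  blocks B d.+1 = if width B (blocks B d) <= d then (blocks B d).+1 else blocks B d.
Proof.
move=> hd; have hb := blocks_le (leqnn _) (ltnW hd).
case: leqP => hw; apply: blocks_unique => //.
- exact: blocks_lt_size.
- have hs := blocks_lt_size hd hw; rewrite widthS //.
  have := width_gt0 hs; have := width_blocks (ltnW hd); lia.
- by move=> h'; rewrite !ltnS => /width_mono /leq_trans; apply.
- by move=> h' /(width_lt_blocks (ltnW hd)) /ltnW.
Qed.

End Blocking.

Fixpoint comb (C : eqType) (c : C) (s : seq C) : tree C :=
  if s is c' :: s' then Node (Leaf c) (comb c' s') else Leaf c.

Lemma leaves_comb (C : eqType) (c : C) s : leaves (comb c s) = c :: s.
Proof. by elim: s c => //= c' s IH c; rewrite IH. Qed.

Lemma depth_comb (C : eqType) (c : C) s :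
  uniq (c :: s) -> depth (comb c s) (last c s) = size s.
Proof.
elim: s c => //= c' s IH c /andP[hc hu]; rewrite inE.
case: eqP => [e|_]; last by rewrite IH.
by case/negP: hc; rewrite -e mem_last.
Qed.

(** The caterpillar [comb] places its last character at depth [n - 1], so [long_enough], applied to
    it, reaches every depth below [n]. *)
Lemma long_enough_width (R : realDomainType) n (B : seq (nat * R)) d :
  long_enough 'I_n B -> d < n -> d <= width B (size B).
Proof.
move=> hB hd; case e : (enum 'I_n) => [|c s].
  by move: hd; rewrite -(size_enum_ord n) e.
have [|h hs hw] := hB (comb c s) (last c s).
  by rewrite /prefix_tree leaves_comb e.
apply: leq_trans (width_mono B hs); apply: leq_trans hw.
rewrite depth_comb -?e ?enum_uniq //.
by move: hd; rewrite -{1}(size_enum_ord n) e.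
Qed.

(** * From table entries to solutions of the problem *)

Section Solution.
Variables (R : realDomainType) (n : nat) (freq : 'I_n -> nat).
Variables (B : seq (nat * R)) (L : nat) (g : nat -> 'I_n).
Hypothesis n_gt0 : 0 < n.
Hypothesis B_scheme : blocking_scheme B.
Hypothesis g_perm : perm_eq (mkseq g n) (enum 'I_n).
Hypothesis g_sorted :
  forall r r', r <= r' -> r' < n -> freq (g r) <= freq (g r').

Local Notation D := (fun d => access B (blocks B d)).
Local Notation tab := (tab freq D n g).
Local Notation best_forest := (best_forest freq D n g).

Lemma sum_depth (V : nmodType) (h : 'I_n -> nat -> V) T : prefix_tree T ->
  (\sum_(c : 'I_n) h c (depth T c) = \sum_(x <- leaf_depths 0 T) h x.2 x.1)%R.
Proof.
move=> hT; rewrite -depth_leaf_depths; last by rewrite (perm_uniq hT) enum_uniq.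
by rewrite [RHS](perm_big _ hT) big_enum.
Qed.

Lemma len_forest T : prefix_tree T -> len freq T = forest_len freq 0 [:: T].
Proof.
move=> hT; rewrite /len (sum_depth (fun c d => freq c * d)) //.
by rewrite /forest_len /forest_depths /= cats0.
Qed.

Lemma decode_time_forest T : prefix_tree T ->
  decode_time freq B T = forest_time freq D 0 [:: T].
Proof.
move=> hT; rewrite /decode_time /char_decode_time.
rewrite (sum_depth (fun c d => ((freq c)%:R * access B (blocks B d))%R)) //.
by rewrite /forest_time /forest_depths /= cats0.
Qed.

Lemma prefix_tree_depths T :
  prefix_tree T <-> perm_eq [seq x.2 | x <- forest_depths 0 [:: T]] (mkseq g n).
Proof.
rewrite /forest_depths /= cats0 leaf_depths_leaves.
by rewrite (permPr g_perm).
Qed.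

Lemma tab_lower_bound T : feasible freq L T ->
  (0 < (tab n n 1 L).1) && ((tab n n 1 L).2 <= decode_time freq B T)%R.
Proof.
move=> [hT hl]; have := @tab_optimal R _ freq D n g _ g_sorted _ n n 1 L [:: T].
rewrite subnn decode_time_forest //; apply => //.
- by move=> d e hde; apply/access_mono/blocks_mono.
- have : uniq (mkseq g n) by rewrite (perm_uniq g_perm) enum_uniq.
  by move/mkseq_uniqP.
- by rewrite n_gt0 leqnn.
- exact/prefix_tree_depths.
(* A tree with [n] leaves has height below [n]: the [n] levels allotted to the root suffice. *)
- rewrite /= andbT; have := height_lt_leaves T.
  by rewrite (perm_size hT) size_enum_ord.
- by rewrite -len_forest.
Qed.

Lemma tab_solution : 0 < (tab n n 1 L).1 ->
  exists2 T, best_forest n n 1 L = [:: T] & DOPT_solution freq B L T.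
Proof.
move=> h; have [] := best_forest_correct h (leqnn n).
rewrite subnn; case: (best_forest _ _ _ _) => [|T []] // _ /prefix_tree_depths hT.
rewrite -len_forest // -decode_time_forest // => hl ht; exists T => //.
by split=> // T' /tab_lower_bound /andP[_]; rewrite ht.
Qed.

Lemma tab_infeasible : (tab n n 1 L).1 = 0 ->
  ~ exists T, feasible freq L T.
Proof. by move=> h [T /tab_lower_bound]; rewrite h. Qed.

End Solution.

(** * Sorting by ranks *)

Section Ranking.
Variables (n : nat) (F : nat -> nat).

(** Breaking ties by index makes this a strict total order, so that ranks are distinct. *)
Definition before (j i : nat) : bool := (F j < F i) || (F j == F i) && (j < i).

Definition rank (i : nat) : nat := count (before^~ i) (iota 0 n).

Lemma before_trans : transitive before.
Proof. by move=> y x z; rewrite /before; lia. Qed.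

(** The predecessors of [j] include those of [i] and also [i] itself, which is not its own
    predecessor. *)
Lemma rank_mono i j : i < n -> before i j -> rank i < rank j.
Proof.
move=> hi hij.
have <- : count (predU (pred1 i) (before^~ i)) (iota 0 n) = (rank i).+1.
  have := count_predUI (pred1 i) (before^~ i) (iota 0 n).
  rewrite (@eq_count _ (predI _ _) pred0) ?count_pred0; last first.
    by move=> x /=; case: eqP => // ->; rewrite /before; lia.
  by rewrite addn0 => ->; rewrite count_uniq_mem ?iota_uniq // mem_iota hi.
apply: sub_count => x /= /orP[/eqP -> //|hx]; exact: before_trans hij.
Qed.

Lemma rank_lt i : i < n -> rank i < n.
Proof.
move=> hi; rewrite -[X in _ < X](size_iota 0) ltn_neqAle count_size andbT.
rewrite -all_count; apply/negP => /allP /(_ i); rewrite mem_iota hi /before.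
by move/(_ isT); lia.
Qed.

Lemma rank_le i j : i < n -> j < n -> rank i <= rank j -> F i <= F j.
Proof.
move=> hi hj; rewrite leqNgt; case: (leqP (F i)) => // h /negP[].
by apply: rank_mono; rewrite // /before h.
Qed.

Lemma rank_inj i j : i < n -> j < n -> rank i = rank j -> i = j.
Proof.
move=> hi hj e; case: (boolP (before i j)) => [/(rank_mono hi)|h1].
  by rewrite e ltnn.
case: (boolP (before j i)) => [/(rank_mono hj)|h2]; first by rewrite e ltnn.
by move: h1 h2; rewrite /before; lia.
Qed.
End Ranking.

Lemma sorting_exists n (freq : 'I_n -> nat) (F : nat -> nat) : 0 < n ->
  (forall c : 'I_n, F c = freq c) ->
  exists g : nat -> 'I_n,
  [/\ perm_eq (mkseq g n) (enum 'I_n),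
      forall r r', r <= r' -> r' < n -> freq (g r) <= freq (g r')
    & forall r, r < n -> rank n F (g r) = r].
Proof.
move=> n0 hF.
pose rk (c : 'I_n) : 'I_n := Ordinal (rank_lt F (ltn_ord c)).
have rk_inj : injective rk.
  by move=> c c' [] /(rank_inj (ltn_ord c) (ltn_ord c')) /val_inj.
(* The sorted enumeration inverts the rank function; the default [Ordinal n0], available since
   [n > 0], fills the places beyond [n]. *)
pose g r := invF rk_inj (insubd (Ordinal n0) r).
have rkg r : r < n -> rank n F (g r) = r.
  move=> hr; rewrite -[LHS]/(val (rk (g r))) /g f_invF.
  by rewrite val_insubd hr.
exists g; split=> // [|r r' hrr' hr'].
  apply: uniq_perm; rewrite ?enum_uniq //.
    apply/mkseq_uniqP => r r'; rewrite !inE => hr hr' e.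
    by rewrite -(rkg r) // e rkg.
  move=> c; rewrite mem_enum /=; apply/mapP; exists (rank n F c).
    by rewrite mem_iota rank_lt.
  by refine (rk_inj _ _ (val_inj _)); rewrite /= rkg ?rank_lt.
have hr := leq_ltn_trans hrr' hr'.
by rewrite -!hF; apply: rank_le => //; rewrite !rkg.
Qed.

(** * A program logic with running times *)

Section Logic.
Variable R : realDomainType.
Implicit Types (s : state R) (c : cmd) (Q : state R -> Prop).

Definition runs c s (T : nat) Q : Prop :=
  exists s' t, [/\ exec c s s' t, t <= T & Q s'].

Lemma runs_weaken c s T T' Q Q' :
  runs c s T Q -> T <= T' -> (forall s', Q s' -> Q' s') -> runs c s T' Q'.
Proof.
move=> [s' [t [he ht hQ]]] hT hQQ'; exists s', t; split=> //; last exact: hQQ'.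
exact: leq_trans hT.
Qed.

Lemma runs_leq c s T T' Q : runs c s T Q -> T <= T' -> runs c s T' Q.
Proof. by move=> h hT; apply: runs_weaken h hT _. Qed.

Lemma runs_seq c1 c2 s T1 T2 Q :
  runs c1 s T1 (fun s1 => runs c2 s1 T2 Q) -> runs (Seq c1 c2) s (T1 + T2) Q.
Proof.
move=> [s1 [t1 [he1 ht1 [s2 [t2 [he2 ht2 hQ]]]]]].
by exists s2, (t1 + t2); split; [exact: ExecSeq he1 he2|exact: leq_add|].
Qed.

Lemma runs_if b c1 c2 s T Q :
  runs (if beval s b then c1 else c2) s T Q ->
  runs (If b c1 c2) s (bcost b + T).+1 Q.
Proof.
move=> [s' [t [he ht hQ]]]; exists s', (bcost b + t).+1.
by split=> //; [exact: ExecIf|rewrite ltnS leq_add2l].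
Qed.

Fixpoint straight c : bool :=
  match c with
  | Seq c1 c2 | If _ c1 c2 => straight c1 && straight c2
  | While _ _ => false
  | _ => true
  end.

(** Adding the costs of both branches bounds either one, so the bound is a closed number independent
    of the state. *)
Fixpoint straight_cost c : nat :=
  match c with
  | NSet _ i e => (sumn (map ncost i) + ncost e).+1
  | RSet _ i e => (sumn (map ncost i) + rcost e).+1
  | Seq c1 c2 => straight_cost c1 + straight_cost c2
  | If b c1 c2 => (bcost b + (straight_cost c1 + straight_cost c2)).+1
  | _ => 1
  end.

Fixpoint run c s : state R :=
  match c with
  | NSet a i e => State (upd (nmem s) a (map (neval s) i) (neval s e)) (rmem s)
  | RSet a i e => State (nmem s) (upd (rmem s) a (map (neval s) i) (reval s e))
  | Seq c1 c2 => run c2 (run c1 s)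
  | If b c1 c2 => if beval s b then run c1 s else run c2 s
  | _ => s
  end.

Lemma runs_straight c s Q :
  straight c -> Q (run c s) -> runs c s (straight_cost c) Q.
Proof.
elim: c s Q => //=.
- by move=> s Q _ hQ; exists s, 1; split=> //; exact: ExecSkip.
- by move=> a i e s Q _ hQ; do 2!eexists; split; [exact: ExecNSet| |].
- by move=> a i e s Q _ hQ; do 2!eexists; split; [exact: ExecRSet| |].
- by move=> c1 IH1 c2 IH2 s Q /andP[h1 h2] hQ; apply/runs_seq/IH1 => //; exact: IH2.
- move=> b c1 IH1 c2 IH2 s Q /andP[h1 h2] hQ; apply: runs_if.
  case: ifP hQ => _ hQ.
    by apply: runs_weaken (IH1 _ _ h1 hQ) (leq_addr _ _) _.
  by apply: runs_weaken (IH2 _ _ h2 hQ) (leq_addl _ _) _.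
Qed.

Lemma runs_straightW c s T Q :
  straight c -> straight_cost c <= T -> Q (run c s) -> runs c s T Q.
Proof. by move=> hc hT hQ; apply: runs_weaken (runs_straight hc hQ) hT _. Qed.

Fixpoint nwrites c : seq nat :=
  match c with
  | NSet a _ _ => [:: a]
  | Seq c1 c2 | If _ c1 c2 => nwrites c1 ++ nwrites c2
  | While _ c1 => nwrites c1
  | _ => [::]
  end.

Fixpoint rwrites c : seq nat :=
  match c with
  | RSet a _ _ => [:: a]
  | Seq c1 c2 | If _ c1 c2 => rwrites c1 ++ rwrites c2
  | While _ c1 => rwrites c1
  | _ => [::]
  end.

(** The frame condition: arrays that a program does not mention as targets keep their contents. *)
Definition agree (ws rs : seq nat) s s' : Prop :=
  (forall a i, a \notin ws -> nmem s' a i = nmem s a i) /\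
  (forall a i, a \notin rs -> rmem s' a i = rmem s a i).

Lemma agree_trans ws rs s1 s2 s3 :
  agree ws rs s1 s2 -> agree ws rs s2 s3 -> agree ws rs s1 s3.
Proof.
by move=> [h1 h2] [h3 h4]; split=> a i ha; [rewrite h3 ?h1|rewrite h4 ?h2].
Qed.

Lemma agree_sub ws rs ws' rs' s s' : {subset ws <= ws'} -> {subset rs <= rs'} ->
  agree ws rs s s' -> agree ws' rs' s s'.
Proof.
move=> hw hr [h1 h2]; split=> a i /negP ha; [apply: h1|apply: h2].
  by apply/negP => /hw.
by apply/negP => /hr.
Qed.

Lemma agree_setn ws rs s a i v : a \in ws ->
  agree ws rs s (State (upd (nmem s) a i v) (rmem s)).
Proof.
by move=> ha; split=> // a' i' ha'; rewrite /= /upd; case: eqP ha' => // ->; rewrite ha.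
Qed.

Lemma exec_agree c s s' t : exec c s s' t -> agree (nwrites c) (rwrites c) s s'.
Proof.
elim=> {c s s' t} //=.
- by move=> a i e s; apply: agree_setn; rewrite mem_head.
- move=> a i e s; split=> // a' i' /=; rewrite inE /upd => /negbTE ->; by [].
- move=> c1 c2 s1 s2 s3 t1 t2 _ h1 _ h2.
  by apply: agree_trans (agree_sub _ _ h1) (agree_sub _ _ h2) => a ha;
    rewrite mem_cat ha ?orbT.
- move=> b c1 c2 s s' t _; case: ifP => _; apply: agree_sub => a ha;
    by rewrite mem_cat ha ?orbT.
- by move=> b c s1 s2 s3 t1 t2 _ _ h1 _ h2; apply: agree_trans h2.
Qed.

Lemma runs_agree c s T Q : runs c s T Q ->
  runs c s T (fun s' => Q s' /\ agree (nwrites c) (rwrites c) s s').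
Proof.
by move=> [s' [t [he ht hQ]]]; exists s', t; split=> //; split=> //; exact: exec_agree he.
Qed.

Definition For (v : nat) (e : nexp) (body : cmd) : cmd :=
  Seq (NSet v [::] (NConst 0))
    (While (BLe (NAdd (NGet v [::]) (NConst 1)) e)
       (Seq body (NSet v [::] (NAdd (NGet v [::]) (NConst 1))))).

Lemma runs_while_done b c s Q : ~~ beval s b -> Q s ->
  runs (While b c) s (bcost b).+1 Q.
Proof. by move=> hb hQ; exists s, (bcost b).+1; split=> //; exact: ExecWhileDone. Qed.

Lemma runs_while_step b c s T1 T2 Q : beval s b ->
  runs c s T1 (fun s1 => runs (While b c) s1 T2 Q) ->
  runs (While b c) s (bcost b + T1 + T2).+1 Q.
Proof.
move=> hb [s1 [t1 [he1 ht1 [s2 [t2 [he2 ht2 hQ]]]]]].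
exists s2, (bcost b + t1 + t2).+1; split=> //; first exact: ExecWhileStep he2.
by rewrite ltnS leq_add // leq_add2l.
Qed.

(** The bound [e] is evaluated again before each round, so it must be stable under whatever the loop
    writes. The invariant is required after the increment of the counter. *)
Lemma runs_for (inv : nat -> state R -> Prop) N T v e body s :
  v \notin nwrites body ->
  (forall s', agree (v :: nwrites body) (rwrites body) s s' -> neval s' e = N) ->
  inv 0 (State (upd (nmem s) v [::] 0) (rmem s)) ->
  (forall j s', j < N -> nmem s' v [::] = j ->
     agree (v :: nwrites body) (rwrites body) s s' -> inv j s' ->
     runs body s' T (fun s'' => inv j.+1 (State (upd (nmem s'') v [::] j.+1) (rmem s'')))) ->
  runs (For v e body) s ((ncost e + 12) * (N.+1 * T.+1)) (inv N).
Proof.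
move=> hv hN h0 hstep; set ws := v :: _ in hN hstep; set rs := rwrites _ in hN hstep.
set b := BLe (NAdd (NGet v [::]) (NConst 1)) e.
suff loop m j s' : j + m = N -> nmem s' v [::] = j -> agree ws rs s s' ->
    inv j s' ->
    runs (While b (Seq body (NSet v [::] (NAdd (NGet v [::]) (NConst 1))))) s'
      (* A test costs [ncost e + 4], an increment 4, and each loop node 1; with the initial
         assignment of cost 2 the sum fits under the factor [ncost e + 12]. *)
      (m * (ncost e + T + 9) + (ncost e + 5)) (inv N).
  have H1 : runs (NSet v [::] (NConst 0)) s 2
      (fun s' => [/\ nmem s' v [::] = 0, agree ws rs s s' & inv 0 s']).
    apply: runs_straight => //; split=> //=; first by rewrite /upd !eqxx.
    by apply: agree_setn; rewrite mem_head.
  have H2 := runs_seq (runs_weaken H1 (leqnn _) (fun s' h =>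
    let: And3 h1 h2 h3 := h in loop N 0 s' (add0n N) h1 h2 h3)).
  by apply: runs_weaken H2 _ _ => //; nia.
elim: m j s' => [|m IH] j s' hj hvj hag hi.
  apply: (runs_weaken (Q := inv N) (runs_while_done _ _ _)).
  - by rewrite /= hvj (hN _ hag); lia.
  - by move: hi; rewrite -hj addn0; apply.
  - by rewrite /=; lia.
  - by [].
apply: (runs_weaken (Q := inv N) (runs_while_step (T1 := T + 4)
  (T2 := m * (ncost e + T + 9) + (ncost e + 5)) _ _)).
- by rewrite /= hvj (hN _ hag); lia.
- apply: runs_seq; apply: runs_weaken (runs_agree (hstep j s' _ hvj hag hi)) (leqnn _) _.
    by lia.
  move=> s'' [hi' hag']; apply: runs_straight => //.
  have hv'' : nmem s'' v [::] = j by rewrite hag'.1.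
  apply: (IH j.+1); first by lia.
  + by rewrite /= /upd !eqxx /= hv'' addn1.
  + apply: agree_trans hag (agree_trans (agree_sub _ _ hag') (agree_setn _ _ _ _ _)) => //.
      by move=> a ha; rewrite inE ha orbT.
    by rewrite mem_head.
  + by rewrite /= hv'' addn1.
- by rewrite /=; nia.
- by [].
Qed.

End Logic.

(** * Sorting and tabulation *)

(* Integer arrays beyond the input and output ones: 11 maps a rank to its
   character, 16 holds the products depth * frequency by depth and rank, 17 the
   first components of the dynamic program; 12-15 are loop counters, 18-26
   scratch scalars.  R-array 1 holds the decode time of each depth, R-array 2
   the second components of the dynamic program. *)
Notation var a := (NGet a [::]).
Notation lit := NConst.
Notation assign a e := (NSet a [::] e).
Notation incr a := (NSet a [::] (NAdd (NGet a [::]) (NConst 1))).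

(** The test is [before], with its disjunctions expressed by De Morgan's laws from [BNot] and
    [BAnd]. *)
Definition count_before : cmd :=
  For 13 (var 0)
    (If (BNot (BAnd
           (BNot (BLe (NAdd (NGet 3 [:: var 13]) (lit 1)) (NGet 3 [:: var 12])))
           (BNot (BAnd (BEq (NGet 3 [:: var 13]) (NGet 3 [:: var 12]))
                       (BLe (NAdd (var 13) (lit 1)) (var 12))))))
        (incr 18) Skip).

Definition sort_chars : cmd :=
  For 12 (var 0)
    (Seq (assign 18 (lit 0)) (Seq count_before (NSet 11 [:: var 18] (var 12)))).

(** Cells 22 and 23 hold the number of open blocks and their total width. Depth 0 keeps its initial
    value 0, so [n - 1] rounds cover all depths below [n]. *)
Definition tabulate_decode_times : cmd :=
  For 12 (NSub (var 0) (lit 1))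
    (If (BLe (var 23) (var 12))
       (Seq (RSet 1 [:: NAdd (var 12) (lit 1)]
               (RAdd (RGet 1 [:: var 12]) (RGet 0 [:: var 22])))
       (Seq (assign 23 (NAdd (var 23) (NGet 4 [:: var 22])))
            (incr 22)))
       (RSet 1 [:: NAdd (var 12) (lit 1)] (RGet 1 [:: var 12]))).

Definition tabulate_products : cmd :=
  For 12 (var 0)
    (For 13 (var 0)
      (NSet 16 [:: NAdd (var 12) (lit 1); var 13]
         (NAdd (NGet 16 [:: var 12; var 13]) (NGet 3 [:: NGet 11 [:: var 13]])))).

Section Phases.
Variable R : realDomainType.
Implicit Types (s : state R).

Lemma runs_count_before n F i s :
  nmem s 0 [::] = n -> (forall c, nmem s 3 [:: c] = F c) ->
  nmem s 12 [::] = i -> nmem s 18 [::] = 0 ->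
  runs count_before s (13 * (n.+1 * 50)) (fun s' => nmem s' 18 [::] = rank n F i).
Proof.
move=> hn hF hi h0.
apply: runs_weaken (runs_for (T := 49) (N := n)
  (inv := fun j s => nmem s 18 [::] = count (before F ^~ i) (iota 0 j)) _ _ _ _) _ _ => //.
- by move=> s' [h _] /=; rewrite h.
- move=> j s' hj hvj [hag _] hcnt.
  apply: runs_straightW => //.
  have h12 : nmem s' 12 [::] = i by rewrite hag.
  have h3 c : nmem s' 3 [:: c] = F c by rewrite hag.
  rewrite -(addn1 j) iotaD count_cat /= add0n -hcnt addn0 hvj h12 !h3.
  rewrite negb_and !negbK !addn1 -/(before F j i).
  by case: (before F j i); rewrite /= /upd /= ?addn0 ?addn1.
Qed.

Lemma runs_sort_chars n F s :
  nmem s 0 [::] = n -> (forall c, nmem s 3 [:: c] = F c) ->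
  runs sort_chars s (13 * (n.+1 * (13 * (n.+1 * 50) + 10)))
    (fun s' => forall c, c < n -> nmem s' 11 [:: rank n F c] = c).
Proof.
move=> hn hF.
apply: runs_weaken (runs_for (T := (13 * (n.+1 * 50)) + 9) (N := n)
  (inv := fun j s => forall c, c < j -> nmem s 11 [:: rank n F c] = c) _ _ _ _) _ _ => //.
- by move=> s' [h _] /=; rewrite h.
- move=> i s' hi hvi [hag _] hinv.
  apply: (runs_weaken (T := 2 + (13 * (n.+1 * 50) + 3)) (runs_seq _)); last 1 first.
  + by move=> s'' h; exact: h.
  + apply: runs_straight => //; apply: runs_seq.
    apply: runs_weaken (runs_agree
      (runs_count_before (n := n) (F := F) (i := i) _ _ _ _)) _ _ => //=.
    * by rewrite /upd /= hag.
    * by move=> c; rewrite /upd /= hag.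
    move=> s2 [hrk [hag2 _]].
    have h11 x : nmem s2 11 x = nmem s' 11 x by rewrite hag2.
    have h12 : nmem s2 12 [::] = i by rewrite hag2.
    apply: (@runs_straight _ (NSet 11 [:: var 18] (var 12))) => // c hc.
    rewrite /= /upd /= hrk h12.
    case: eqP => [[e]|ne].
      by apply/esym/(rank_inj (n := n) (F := F)) => //; lia.
    rewrite h11 hinv //; move: hc; rewrite ltnS leq_eqVlt => /orP[/eqP ec|//].
    by case: ne; rewrite ec.
  + lia.
- by rewrite /=; lia.
Qed.

Lemma runs_tabulate_decode_times n (B : seq (nat * R)) s :
  blocking_scheme B -> (forall d, d < n -> d <= width B (size B)) ->
  nmem s 0 [::] = n -> (forall j, nmem s 4 [:: j] = nth 0 (map fst B) j) ->
  (forall j, rmem s 0 [:: j] = nth 0%R (map snd B) j) ->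
  nmem s 22 [::] = 0 -> nmem s 23 [::] = 0 -> rmem s 1 [:: 0] = 0%R ->
  runs tabulate_decode_times s (15 * (n.+1 * 50))
    (fun s' => forall d, d < n -> rmem s' 1 [:: d] = access B (blocks B d)).
Proof.
move=> hB hlong hn h4 h0 h22 h23 h1.
apply: runs_weaken (runs_for (T := 49) (N := n - 1)
  (inv := fun j s => [/\ nmem s 22 [::] = blocks B j,
     nmem s 23 [::] = width B (blocks B j)
     & forall d, d <= j -> rmem s 1 [:: d] = access B (blocks B d)]) _ _ _ _) _ _ => //.
- by move=> s' [h _] /=; rewrite h // hn.
- rewrite blocks0; split=> //; first by rewrite /width take0 big_nil.
  by move=> d; rewrite leqn0 => /eqP ->; rewrite blocks0 /access take0 big_nil.
- move=> j s' hj hvj [hag hag'] [i22 i23 i1].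
  apply: runs_straightW => //.
  have r0 x : rmem s' 0 [:: x] = nth 0%R (map snd B) x by rewrite hag'.
  have hjw : j < width B (size B) by apply: hlong; lia.
  rewrite /= hvj i23 blocksS //; case: leqP => hw /=; rewrite /upd /= ?hvj ?i22 ?i23.
    have hs := blocks_lt_size hjw hw.
    rewrite addn1 hag // h4 widthS //; split=> // d.
    rewrite leq_eqVlt => /orP[/eqP -> |hd].
      by rewrite addn1 eqxx r0 i1 // blocksS // hw accessS.
    by rewrite eqseq_cons addn1 (ltn_eqF hd) /= i1.
  split=> // d; rewrite leq_eqVlt => /orP[/eqP -> |hd].
    by rewrite addn1 eqxx i1 // blocksS // leqNgt hw.
  by rewrite eqseq_cons addn1 (ltn_eqF hd) /= i1.
- by rewrite /=; nia.
- by move=> s' [_ _ h] d hd; apply: h; lia.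
Qed.

Lemma runs_tabulate_products n (f : nat -> nat) s :
  nmem s 0 [::] = n ->
  (forall r, r < n -> nmem s 3 [:: nmem s 11 [:: r]] = f r) ->
  (forall x, nmem s 16 x = 0) ->
  runs tabulate_products s (13 * (n.+1 * (13 * (n.+1 * 30)).+1))
    (fun s' => forall d r, d < n -> r < n -> nmem s' 16 [:: d; r] = d * f r).
Proof.
move=> hn hf h0.
apply: runs_weaken (runs_for (T := 13 * (n.+1 * 30)) (N := n)
  (inv := fun j s => forall d r, d <= j -> r < n ->
     nmem s 16 [:: d; r] = d * f r) _ _ _ _) _ _ => //.
- by move=> s' [h _] /=; rewrite h.
- by move=> d r; rewrite leqn0 => /eqP -> _; exact: h0.
- move=> i s1 hi hvi [hag _] hinv.
  apply: runs_weaken (runs_for (T := 29) (N := n)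
    (inv := fun j s => forall d r, d <= i \/ d = i.+1 /\ r < j -> r < n ->
     nmem s 16 [:: d; r] = d * f r) _ _ _ _) _ _ => //.
  + by move=> s' [h _] /=; rewrite h // hag.
  + by move=> d r [hd|[_]//]; exact: hinv.
  + move=> j s2 hj hvj [hag2 _] hinv2.
    apply: runs_straightW => // d r hd hr.
    have h12 : nmem s2 12 [::] = i by rewrite hag2.
    have h3 : nmem s2 3 [:: nmem s2 11 [:: j]] = f j by rewrite !hag2 // !hag // hf.
    rewrite /= /upd /= hvj h12 h3 addn1 !eqseq_cons andbT.
    case: andP => [[/eqP -> /eqP ->]|hne]; first by rewrite hinv2 //; [lia|left].
    rewrite hinv2 //; case: hd => [|[e1 e2]]; first by left.
    have : r <> j by move=> e; apply: hne; rewrite e1 e !eqxx.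
    by right; split=> //; lia.
  + by move=> s' h d r hd hr; apply: h => //; lia.
- by move=> s' h d r hd; apply: h; exact: ltnW.
Qed.
End Phases.

(** * Filling the table *)

Definition level_exp : nexp := NSub (NSub (var 0) (lit 1)) (var 12).
Definition item_exp : nexp := NSub (var 13) (lit 1).
Definition product_exp : nexp := NGet 16 [:: level_exp; item_exp].

(** Counter 12 runs from 0 while the level being filled is one higher; level 0 keeps its initial
    zeros, which are the values of [tab 0]. *)
Definition this_cell : seq nexp :=
  [:: NAdd (var 12) (lit 1); var 13; var 14; var 15].
Definition leaf_cell : seq nexp :=
  [:: NAdd (var 12) (lit 1); item_exp; NSub (var 14) (lit 1);
      NSub (var 15) product_exp].
Definition level_cell : seq nexp :=
  [:: var 12; var 13; NAdd (var 14) (var 14); var 15].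

Definition try_leaf : cmd :=
  If (BAnd (BLe product_exp (var 15)) (BLe (lit 1) (NGet 17 leaf_cell)))
    (Seq (NSet 17 this_cell (lit 1))
         (RSet 2 this_cell
            (RAdd (RGet 2 leaf_cell)
               (RScale (NGet 3 [:: NGet 11 [:: item_exp]])
                  (RGet 1 [:: level_exp])))))
    Skip.

Definition try_level : cmd :=
  If (BAnd (BLe (lit 1) (NGet 17 level_cell))
           (BNot (BAnd (BNot (BEq (NGet 17 this_cell) (lit 0)))
                       (BLeR (RGet 2 this_cell) (RGet 2 level_cell)))))
    (Seq (NSet 17 this_cell (lit 2)) (RSet 2 this_cell (RGet 2 level_cell)))
    Skip.

Definition fill_cell : cmd :=
  If (BEq (var 13) (lit 0))
    (If (BEq (var 14) (lit 0)) (NSet 17 this_cell (lit 1)) Skip)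
    (If (BEq (var 14) (lit 0)) Skip (Seq try_leaf try_level)).

Definition fill_table : cmd :=
  For 12 (var 0) (For 13 (NAdd (var 0) (lit 1)) (For 14 (NAdd (var 0) (lit 1))
    (For 15 (NAdd (var 1) (lit 1)) fill_cell))).

Section FillTable.
Variables (R : realDomainType) (C : eqType) (freq : C -> nat) (D : nat -> R).
Variables (n L : nat) (g : nat -> C).
Implicit Types (s : state R).

Local Notation fs r := (freq (g r)).
Local Notation tab := (tab freq D n g).

Definition cell s (x : seq nat) : nat * R := (nmem s 17 x, rmem s 2 x).

Definition tables s : Prop :=
  [/\ nmem s 0 [::] = n, nmem s 1 [::] = L,
      forall r, r < n -> nmem s 3 [:: nmem s 11 [:: r]] = fs r,
      forall d r, d < n -> r < n -> nmem s 16 [:: d; r] = d * fs r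
    & forall d, d < n -> rmem s 1 [:: d] = D d].

Definition indices s k r b l : Prop :=
  [/\ nmem s 12 [::] = k, nmem s 13 [::] = r, nmem s 14 [::] = b
    & nmem s 15 [::] = l].

Lemma tables_agree s s' : agree [:: 12; 13; 14; 15; 17] [:: 2] s s' ->
  tables s -> tables s'.
Proof.
move=> [h h'] [h0 h1 h3 h16 hD].
split; [by rewrite h|by rewrite h|move=> r hr|move=> d r hd hr|move=> d hd].
- by rewrite !h // h3.
- by rewrite h // h16.
- by rewrite h' // hD.
Qed.

Section OneCell.
Variables (s : state R) (k r b l : nat).
Hypotheses (hk : k < n) (hr : r < n).
Hypotheses (hs : tables s) (hi : indices s k r.+1 b.+1 l).

Lemma neval_level : neval s level_exp = n - k.+1.
Proof. by case: hs hi => [h0 _ _ _ _] [h12 _ _ _]; rewrite /= h0 h12 -subnDA. Qed.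

Lemma neval_item : neval s item_exp = r.
Proof. by case: hi => [_ h13 _ _]; rewrite /= h13 subn1. Qed.

Lemma neval_product : neval s product_exp = (n - k.+1) * fs r.
Proof.
rewrite -[LHS]/(nmem s 16 [:: neval s level_exp; neval s item_exp]).
rewrite neval_level neval_item.
by case: hs => [_ _ _ -> //]; lia.
Qed.

Lemma neval_this : map (neval s) this_cell = [:: k.+1; r.+1; b.+1; l].
Proof. by case: hi => [h12 h13 h14 h15]; rewrite /= h12 h13 h14 h15 addn1. Qed.

Lemma neval_leaf : map (neval s) leaf_cell = [:: k.+1; r; b; l - (n - k.+1) * fs r].
Proof.
rewrite -[LHS]/[:: nmem s 12 [::] + 1; neval s item_exp; nmem s 14 [::] - 1;
  nmem s 15 [::] - neval s product_exp] neval_product neval_item.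
by case: hi => [-> _ -> ->]; rewrite addn1 subn1.
Qed.

Lemma neval_level_cell : map (neval s) level_cell = [:: k; r.+1; b.+1 + b.+1; l].
Proof. by case: hi => [h12 h13 h14 h15]; rewrite /= h12 h13 h14 h15. Qed.

Lemma neval_freq : neval s (NGet 3 [:: NGet 11 [:: item_exp]]) = fs r.
Proof.
rewrite -[LHS]/(nmem s 3 [:: nmem s 11 [:: neval s item_exp]]) neval_item.
by case: hs => [_ _ -> //].
Qed.
End OneCell.

Lemma try_leaf_cell s k r b l x : k < n -> r < n ->
  tables s -> indices s k r.+1 b.+1 l ->
  cell s [:: k.+1; r.+1; b.+1; l] = (0, 0%R) ->
  (forall l', l' <= l -> cell s [:: k.+1; r; b; l'] = tab k.+1 r b l') ->
  cell (run try_leaf s) x =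
    if x == [:: k.+1; r.+1; b.+1; l]
    then leaf_option freq D n g k r (tab k.+1 r b) l else cell s x.
Proof.
move=> hk hr hs hi h0 hprev; have /hprev := leq_subr ((n - k.+1) * fs r) l.
rewrite /leaf_option; case: (tab _ _ _ _) => [t v] [ht hv].
rewrite /try_leaf; cbn [run beval].
rewrite (neval_product hk hr hs hi); cbn [neval]; rewrite (neval_leaf hk hr hs hi) ht.
have h15 : nmem s 15 [::] = l by case: hi.
rewrite [map _ [::]]/= h15; case: ifP => _; last by case: eqP => // ->.
rewrite (neval_this hi); set s1 := State _ (rmem s).
have hs1 : tables s1 by []. have hi1 : indices s1 k r.+1 b.+1 l by [].
rewrite (neval_this hi1) -[reval _ _]/(rmem s1 2 (map (neval s1) leaf_cell)
  + (neval s1 (NGet 3 [:: NGet 11 [:: item_exp]]))%:R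
    * rmem s1 1 [:: neval s1 level_exp])%R.
rewrite (neval_leaf hk hr hs1 hi1) (neval_freq hr hs1 hi1) (neval_level hs1 hi1).
rewrite /cell /= /upd /=; case: eqP => // _.
by rewrite hv; case: hs => [_ _ _ _ ->] //; lia.
Qed.

Lemma try_level_cell s k r b l x (A Bo : nat * R) :
  indices s k r.+1 b.+1 l ->
  cell s [:: k.+1; r.+1; b.+1; l] = A ->
  cell s [:: k; r.+1; b.+1 + b.+1; l] = Bo ->
  cell (run try_level s) x =
    if x == [:: k.+1; r.+1; b.+1; l] then better A Bo else cell s x.
Proof.
case: A Bo => [a1 a2] [b1 b2] hi [h1 h2] [h3 h4]; rewrite /better.
rewrite /try_level; cbn [run beval neval reval].
rewrite (neval_this hi) (neval_level_cell hi) h1 h2 h3 h4 negb_and negbK [in RHS]/=.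
case: ifP => _; last by case: eqP => // ->; rewrite /cell h1 h2.
set s1 := State _ (rmem s); have hi1 : indices s1 k r.+1 b.+1 l by [].
rewrite (neval_this hi1) (neval_level_cell hi1).
by rewrite /cell /= /upd /=; case: eqP => // _; rewrite h4.
Qed.

(** The cells that precede [(k.+1, r, b, l)] in the lexicographic order of the four loops. *)
Definition done k r b l (k' r' b' l' : nat) : bool :=
  [&& r' <= n, b' <= n, l' <= L &
    (k' <= k) || (k' == k.+1) && ((r' < r) || (r' == r) &&
      ((b' < b) || (b' == b) && (l' < l)))].

(** Pending cells must still be zero: [fill_cell] writes only feasible entries, and [try_level]
    recognises a failed leaf by the zero left in the cell. *)
Definition filled k r b l s : Prop :=
  forall k' r' b' l', cell s [:: k'; r'; b'; l'] =
    if done k r b l k' r' b' l' then tab k' r' b' l' else (0, 0%R).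

Lemma fill_cell_filled s k r b l : k < n -> r <= n -> b <= n -> l <= L ->
  tables s -> indices s k r b l -> filled k r b l s ->
  filled k r b l.+1 (run fill_cell s).
Proof.
move=> hk hr hb hl hs hi hf.
have hcur : cell s [:: k.+1; r; b; l] = (0, 0%R).
  by rewrite hf /done; case: ifP => //; lia.
suff H x : cell (run fill_cell s) x =
    if x == [:: k.+1; r; b; l] then tab k.+1 r b l else cell s x.
  move=> k' r' b' l'; rewrite H !eqseq_cons andbT hf.
  case: ifP => [/and4P[/eqP -> /eqP -> /eqP -> /eqP ->]|ne].
    by rewrite ifT // /done; lia.
  have -> // : done k r b l.+1 k' r' b' l' = done k r b l k' r' b' l'.
  by move: ne; rewrite /done; lia.
have [h12 h13 h14 h15] := hi.
case: r hr hi hf hcur h13 => [|r] hr hi hf hcur h13;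
  case: b hb hi hf hcur h14 => [|b] hb hi hf hcur h14;
  rewrite /fill_cell; cbn [run beval neval]; rewrite [map _ [::]]/= h13 h14 [_ == _]/=.
- rewrite [0 == _]/= /= h12 h13 h14 h15 /cell /= addn1 /upd /=.
  by case: eqP => // ->; case: hcur => _ ->.
- by rewrite -[LHS]/(cell s x); case: eqP => // ->; rewrite hcur /= hb.
- by rewrite -[LHS]/(cell s x); case: eqP => // ->; rewrite hcur.
- rewrite -[LHS]/(cell (run try_level (run try_leaf s)) x).
  have hA y := try_leaf_cell y hk hr hs hi hcur _.
  have hi1 : indices (run try_leaf s) k r.+1 b.+1 l.
    by rewrite /try_leaf [run _ _]/=; case: ifP.
  have {}hA y : cell (run try_leaf s) y = if y == [:: k.+1; r.+1; b.+1; l]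
      then leaf_option freq D n g k r (tab k.+1 r b) l else cell s y.
    by apply: hA => l' hl'; rewrite hf ifT // /done; lia.
  have hBo : cell (run try_leaf s) [:: k; r.+1; b.+1 + b.+1; l]
      = tab k r.+1 (b.+1 + b.+1) l.
    (* Doubling may lead beyond column [n]; such a cell was never written, and its zero agrees with
       [tab_small]. *)
    rewrite hA !eqseq_cons (ltn_eqF (ltnSn k)) /= hf; case: ifP => //.
    by move=> hnd; rewrite tab_small //; move: hnd; rewrite /done; lia.
  have := try_level_cell x hi1 (hA _) hBo; rewrite eqxx -tabSS // => ->.
  by case: eqP => // hx; rewrite hA; case: eqP.
Qed.

Lemma filled_ext k r b l k1 r1 b1 l1 s :
  (forall k' r' b' l', done k r b l k' r' b' l' = done k1 r1 b1 l1 k' r' b' l') ->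
  filled k r b l s -> filled k1 r1 b1 l1 s.
Proof. by move=> he hf k' r' b' l'; rewrite hf he. Qed.

(** The factors 13 and 15 are the 12 of [runs_for] plus the cost of the loop bound: 1 for a
    variable, 3 for a variable plus a literal. *)
Definition fill_table_cost : nat :=
  let T1 := 15 * (L.+2 * (straight_cost fill_cell).+1) in
  let T2 := 15 * (n.+2 * T1.+1) in
  let T3 := 15 * (n.+2 * T2.+1) in
  13 * (n.+1 * T3.+1).

Lemma runs_fill_table s : tables s -> (forall x, cell s x = (0, 0%R)) ->
  runs fill_table s fill_table_cost (filled n 0 0 0).
Proof.
move=> hs h0.
have bound0 s' : agree [:: 12; 13; 14; 15; 17] [:: 2] s s' -> nmem s' 0 [::] = n.
  by move=> hag; case: (tables_agree hag hs).
have bound1 s' : agree [:: 12; 13; 14; 15; 17] [:: 2] s s' -> nmem s' 1 [::] = L.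
  by move=> hag; case: (tables_agree hag hs).
have sub ws rs s1 s2 : agree ws rs s1 s2 ->
    all (mem [:: 12; 13; 14; 15; 17]) ws -> all (mem [:: 2]) rs ->
    agree [:: 12; 13; 14; 15; 17] [:: 2] s1 s2.
  by move=> h /allP h1 /allP h2; apply: agree_sub h.
lazy delta [fill_table_cost] zeta; set T1 := 15 * (L.+2 * _).
set T2 := 15 * (n.+2 * T1.+1); set T3 := 15 * (n.+2 * T2.+1).
apply: (runs_for (N := n) (T := T3) (inv := fun k => filled k 0 0 0)) => //.
- by move=> s' hag; apply/bound0/(sub _ _ _ _ hag).
- move=> k' r' b' l'; have := h0 [:: k'; r'; b'; l']; rewrite /cell => ->.
  by rewrite /done; case: ifP => // /and4P[_ _ _]; case: k' => //; lia.
move=> k s1 hk hk1 /sub /(_ isT isT) hag1 hf1.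
apply: (runs_weaken (T := T3) (Q := filled k n.+1 0 0)); last first.
(* A carry: completing the last row of a level is the same as being at the start of the next
   level. *)
- by move=> s'; apply: filled_ext => k' r' b' l'; rewrite /done; lia.
- exact: leqnn.
apply: (runs_for (N := n.+1) (T := T2) (inv := fun r => filled k r 0 0)) => //.
- move=> s' /sub /(_ isT isT) /(agree_trans hag1) hag /=.
  by rewrite bound0 // addn1.
move=> r s2 hr hr1 /[dup] hag2' /sub /(_ isT isT) /(agree_trans hag1) hag2 hf2.
apply: (runs_weaken (T := T2) (Q := filled k r n.+1 0)); last first.
- by move=> s'; apply: filled_ext => k' r' b' l'; rewrite /done; lia.
- exact: leqnn.
apply: (runs_for (N := n.+1) (T := T1) (inv := fun b => filled k r b 0)) => //.
- move=> s' /sub /(_ isT isT) /(agree_trans hag2) hag /=.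
  by rewrite bound0 // addn1.
move=> b s3 hb hb1 /[dup] hag3' /sub /(_ isT isT) /(agree_trans hag2) hag3 hf3.
apply: (runs_weaken (T := T1) (Q := filled k r b L.+1)); last first.
- by move=> s'; apply: filled_ext => k' r' b' l'; rewrite /done; lia.
- exact: leqnn.
apply: (runs_for (N := L.+1) (T := straight_cost fill_cell)
  (inv := fun l => filled k r b l)) => //.
- move=> s' /sub /(_ isT isT) /(agree_trans hag3) hag /=.
  by rewrite bound1 // addn1.
move=> l s4 hl hl1 /[dup] hag4' /sub /(_ isT isT) /(agree_trans hag3) hag4 hf4.
apply: runs_straight => //.
apply: fill_cell_filled => //; first exact: tables_agree hs.
split=> //.
- by rewrite hag4'.1 // hag3'.1 // hag2'.1.
- by rewrite hag4'.1 // hag3'.1.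
- by rewrite hag4'.1.
Qed.
End FillTable.

(** * Reading the tree back *)

(** The budget in cell 26 is lowered before cell 25, whose old value selects the character.
    Advancing cell 19 closes one open node. *)
Definition emit_leaf : cmd :=
  Seq (NSet 7 [:: var 19] (lit 0))
  (Seq (NSet 8 [:: var 19] (NGet 11 [:: NSub (var 25) (lit 1)]))
  (Seq (assign 26 (NSub (var 26)
          (NGet 16 [:: NSub (var 0) (var 24); NSub (var 25) (lit 1)])))
  (Seq (assign 25 (NSub (var 25) (lit 1)))
       (incr 19)))).

Definition emit_node : cmd :=
  Seq (NSet 7 [:: NAdd (var 19) (var 12)] (lit 1))
  (Seq (NSet 9 [:: NAdd (var 19) (var 12)]
          (NAdd (var 20) (NAdd (var 12) (var 12))))
       (NSet 10 [:: NAdd (var 19) (var 12)]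
          (NAdd (var 20) (NAdd (NAdd (var 12) (var 12)) (lit 1))))).

Definition emit_level : cmd :=
  Seq (assign 21 (NSub (var 20) (var 19)))
  (Seq (For 12 (var 21) emit_node)
  (Seq (assign 19 (var 20))
  (Seq (assign 20 (NAdd (var 20) (NAdd (var 21) (var 21))))
       (assign 24 (NSub (var 24) (lit 1)))))).

Definition emit_step : cmd :=
  If (BEq (NGet 17 [:: var 24; var 25; NSub (var 20) (var 19); var 26]) (lit 1))
    emit_leaf emit_level.

(* The open nodes of the current level are numbered from cell 19 up to, but
   excluding, cell 20, so that the tree is numbered in breadth-first order. *)
Definition emit_tree : cmd := While (BLe (lit 1) (var 25)) emit_step.

Section Emit.
Variables (R : realDomainType) (n : nat) (freq : 'I_n -> nat) (D : nat -> R).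
Variables (L : nat) (g : nat -> 'I_n).
Implicit Types (s : state R).

Local Notation fs r := (freq (g r)).
Local Notation tab := (tab freq D n g).
Local Notation best_forest := (best_forest freq D n g).

Definition emit_tables s : Prop :=
  [/\ nmem s 0 [::] = n,
      forall r, r < n -> nmem s 11 [:: r] = g r,
      forall d r, d < n -> r < n -> nmem s 16 [:: d; r] = d * fs r
    & forall k r b l, k <= n -> r <= n -> b <= n -> l <= L ->
        nmem s 17 [:: k; r; b; l] = (tab k r b l).1].

Definition emit_writes := [:: 7; 8; 9; 10; 12; 19; 20; 21; 24; 25; 26].

Lemma emit_tables_agree ws s s' : agree ws [::] s s' ->
  all (mem emit_writes) ws -> emit_tables s -> emit_tables s'.
Proof.
move=> [h _] /allP hw [h0 h11 h16 h17].
have {}h a i : a \notin emit_writes -> nmem s' a i = nmem s a i.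
  by move=> ha; apply: h; apply: contra ha => /hw.
split; [by rewrite h|move=> r hr|move=> d r hd hr|move=> k r b l hk hr hb hl].
- by rewrite h // h11.
- by rewrite h // h16.
- by rewrite h // h17.
Qed.

(** Emitted nodes are never overwritten, so links already stored survive the rest of the loop. *)
Definition same_below p s s' : Prop :=
  forall a v, a \in [:: 7; 8; 9; 10] -> v < p ->
    nmem s' a [:: v] = nmem s a [:: v].

Definition emit_state s k r l p b : Prop :=
  [/\ nmem s 24 [::] = k, nmem s 25 [::] = r, nmem s 26 [::] = l,
      nmem s 19 [::] = p & nmem s 20 [::] = p + b].

Lemma emit_leaf_correct s k r l p b : k < n -> r < n ->
  emit_tables s -> emit_state s k.+1 r.+1 l p b.+1 ->
  let s' := run emit_leaf s in
  [/\ emit_state s' k.+1 r (l - (n - k.+1) * fs r) p.+1 b,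
      nmem s' 7 [:: p] = 0, nmem s' 8 [:: p] = g r & same_below p s s'].
Proof.
move=> hk hr [h0 h11 h16 _] [h24 h25 h26 h19 h20] /=.
rewrite /upd /= h24 h25 h26 h19 h0 subn1 /= h11 // h16 //; last by lia.
rewrite !eqxx /= addn1; split=> //; first by split=> //=; rewrite h20 addnS.
move=> a v ha hv /=.
have hvp : ([:: v] == [:: p]) = false by rewrite eqseq_cons (ltn_eqF hv).
by rewrite hvp !andbF; move: ha; rewrite !inE => /or4P[] /eqP ->.
Qed.

Lemma runs_emit_level s k r l p b : b <= n -> emit_state s k.+1 r l p b ->
  runs emit_level s (13 * (n.+1 * 50) + 30) (fun s' =>
    [/\ emit_state s' k r l (p + b) (b + b),
        forall j, j < b -> [/\ nmem s' 7 [:: p + j] = 1,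
          nmem s' 9 [:: p + j] = p + b + j.*2 &
          nmem s' 10 [:: p + j] = p + b + j.*2.+1]
      & same_below p s s']).
Proof.
move=> hb [h24 h25 h26 h19 h20].
apply: (runs_weaken (T := 4 + (13 * (b.+1 * 50) + 12))
  (Q := fun s' => [/\ emit_state s' k r l (p + b) (b + b),
        forall j, j < b -> [/\ nmem s' 7 [:: p + j] = 1,
          nmem s' 9 [:: p + j] = p + b + j.*2 &
          nmem s' 10 [:: p + j] = p + b + j.*2.+1]
      & same_below p s s'])); last by []; last by lia.
apply: runs_seq; apply: runs_straight => //; set s1 := run _ s.
have h21 : nmem s1 21 [::] = b by rewrite /= /upd /= h19 h20 addKn.
apply: runs_seq.
apply: (runs_weaken (runs_agree (runs_for (N := b) (T := 49)
  (inv := fun j s' => (forall i, i < j -> [/\ nmem s' 7 [:: p + i] = 1,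
          nmem s' 9 [:: p + i] = p + b + i.*2 &
          nmem s' 10 [:: p + i] = p + b + i.*2.+1]) /\ same_below p s s')
   _ _ _ _))) => //.
- by move=> s' [h _]; rewrite -h21 -h.
- split=> // a v ha hv /=.
  by rewrite /upd /=; move: ha; rewrite !inE => /or4P[] /eqP ->.
- move=> j s2 hj hvj [hag _] [hi1 hi2].
  have i19 : nmem s2 19 [::] = p by rewrite hag.
  have i20 : nmem s2 20 [::] = p + b by rewrite hag.
  apply: runs_straightW => //; split=> [i hi|a v ha hv] /=.
    rewrite /upd /= i19 i20 hvj; case: (eqVneq i j) => [->|ne].
      by rewrite !eqxx; split=> //; lia.
    rewrite !eqseq_cons eqn_add2l (negbTE ne) /=; apply: hi1.
    by move: ne hi; lia.
  rewrite /upd /= i19 i20 hvj.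
  have hvp : ([:: v] == [:: p + j]) = false by rewrite eqseq_cons ltn_eqF //; lia.
  by rewrite hvp !andbF hi2 //; move: ha; rewrite !inE => /or4P[] /eqP ->.
- move=> s2 [[hj hsame] [hag _]].
  have i24 : nmem s2 24 [::] = k.+1 by rewrite hag.
  have i25 : nmem s2 25 [::] = r by rewrite hag.
  have i26 : nmem s2 26 [::] = l by rewrite hag.
  have i19 : nmem s2 19 [::] = p by rewrite hag.
  have i20 : nmem s2 20 [::] = p + b by rewrite hag.
  have i21 : nmem s2 21 [::] = b by rewrite hag.
  apply: runs_straightW => //; split=> [|i hi|a v ha hv].
  + by split; rewrite /= /upd /= ?i24 ?i25 ?i26 ?i19 ?i20 ?i21 ?subn1.
  + exact: hj.
  + by rewrite -hsame //= /upd; move: ha; rewrite !inE => /or4P[] /eqP ->.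
Qed.

Definition emit_cost : nat := 13 * (n.+1 * 50) + 100.

(** A leaf lowers [r] and a split lowers [k], so [k + r] bounds the number of rounds; each is
    charged the linear cost of a split. Children [2j] and [2j + 1] of the next level match
    [pair_up]. *)
Lemma runs_emit_tree m s k r b l p T0 : k + r <= m -> k <= n -> r <= n -> l <= L ->
  emit_tables s -> emit_state s k r l p b -> 0 < (tab k r b l).1 ->
  runs emit_tree s (m.+1 * emit_cost) (fun s' =>
    (forall j, j < b -> stores s' (p + j) (nth T0 (best_forest k r b l) j)) /\
    same_below p s s').
Proof.
have base s1 k1 b1 l1 p1 m1 : emit_state s1 k1 0 l1 p1 b1 -> 0 < (tab k1 0 b1 l1).1 ->
    runs emit_tree s1 (m1.+1 * emit_cost) (fun s' =>
      (forall j, j < b1 -> stores s' (p1 + j) (nth T0 (best_forest k1 0 b1 l1) j)) /\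
      same_below p1 s1 s').
  move=> [_ h25 _ _ _] htab; rewrite /emit_tree; apply: runs_leq (runs_while_done _ _ _) _.
  - by rewrite /= h25.
  - split; last by [].
    (* With no characters left, feasibility forces [b1 = 0]: no open node remains to be stored. *)
    by move: htab; case: k1 b1 => [|k1] [|b1] //=; case: ifP.
  - by rewrite /emit_cost /=; nia.
elim: m s k r b l p => [|m IH] s k [|r] b l p hm hk hr hl hs hst htab.
- exact: base.
- by move: hm; rewrite addnS.
- exact: base.
case: k hm hk hst htab => [//|k] hm hk hst htab.
case: b hst htab => [|b] hst htab; first by move: htab; rewrite /=.
have hb : b < n by rewrite ltnNge; apply/negP => h; move: htab; rewrite tab_small.
have [h24 h25 h26 h19 h20] := hst; have [h0 h11 h16 h17] := hs.
rewrite {1}/emit_tree; apply: runs_leq (runs_while_step (T1 := 13 * (n.+1 * 50) + 70)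
  (T2 := m.+1 * emit_cost) _ _) _.
- by rewrite /= h25.
- apply: runs_leq (runs_if (T := 13 * (n.+1 * 50) + 50) _) _.
  + rewrite best_forestSS.
    have := tab_step htab.
    have -> : beval s (BEq (NGet 17 [:: var 24; var 25; NSub (var 20) (var 19); var 26])
        (lit 1)) = ((tab k.+1 r.+1 b.+1 l).1 == 1).
      by rewrite /= h24 h25 h26 h19 h20 addKn h17.
    case: ifP => _ hnext.
    * have [e1 e2 e3 e4] := emit_leaf_correct hk hr hs hst.
      apply: (runs_weaken (runs_agree (runs_straight (c := emit_leaf)
        (Q := eq (run emit_leaf s)) _ _))) => //.
      move=> s' [<- hag].
      apply: (runs_weaken (IH _ _ _ _ _ _ _ hk (ltnW hr) _ _ e1 hnext)) => //.
      - by lia.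
      - by apply: leq_trans (leq_subr _ _) hl.
      move=> s2 [hst2 hsame]; split; last first.
        by move=> a v ha hv; rewrite hsame ?e4 // ltnW.
      case=> [|j] hj; last by rewrite addnS -addSn; apply: hst2.
      by rewrite addn0 /= !hsame.
    * apply: (runs_weaken (runs_agree (runs_emit_level hb hst))) => //; first by lia.
      move=> s1 [[hst1 hnodes hsame1] hag].
      apply: (runs_weaken (IH _ _ _ _ _ _ _ (ltnW hk) hr hl _ hst1 hnext)) => //.
      - exact: emit_tables_agree hag _ hs.
      move=> s2 [hst2 hsame]; split; last first.
        by move=> a v ha hv; rewrite hsame ?hsame1 //; lia.
      have [hsz _ _ _] := best_forest_correct hnext (ltnW hk).
      move=> j hj; rewrite nth_pair_up; last by rewrite hsz; lia.
      have [n7 n9 n10] := hnodes _ hj.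
      have hlt : p + j < p + b.+1 by rewrite ltn_add2l.
      rewrite /= !hsame // n7 n9 n10.
      by split=> //; apply: hst2; lia.
  + by rewrite /=; lia.
- by rewrite /emit_cost /=; nia.
Qed.
End Emit.

(** Cells 5, 6 and 19 still hold their initial 0 after the table is filled: status 0 in the
    infeasible case, and otherwise root 0 and first free node 0. *)
Definition solve_DOPT : cmd :=
  Seq sort_chars
  (Seq tabulate_decode_times
  (Seq tabulate_products
  (Seq fill_table
  (If (BEq (NGet 17 [:: var 0; var 0; lit 1; var 1]) (lit 0))
     Skip
     (Seq (Seq (assign 5 (lit 1))
          (Seq (assign 24 (var 0))
          (Seq (assign 25 (var 0))
          (Seq (assign 26 (var 1))
               (assign 20 (lit 1))))))
          emit_tree))))).

(** * Correctness of the whole program *)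

Section Main.
Variables (R : realDomainType) (n : nat) (freq : 'I_n -> nat).
Variables (B : seq (nat * R)) (L : nat).
Hypotheses (n_gt0 : 0 < n) (B_scheme : blocking_scheme B).
Hypothesis B_long : long_enough 'I_n B.

Definition solve_cost : nat :=
  13 * (n.+1 * (13 * (n.+1 * 50) + 10)) + (15 * (n.+1 * 50) +
  (13 * (n.+1 * (13 * (n.+1 * 30)).+1) + (fill_table_cost n L +
  (10 + (20 + (n + n).+1 * emit_cost n)).+1))).

Lemma runs_solve_DOPT :
  runs solve_DOPT (input freq B L) solve_cost (outputs_DOPT freq B L).
Proof.
pose F c := nmem (input freq B L) 3 [:: c].
have hF (c : 'I_n) : F c = freq c by rewrite /F /= valK.
have [g [g_perm g_sorted g_rank]] := sorting_exists n_gt0 hF.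
pose D d := access B (blocks B d).
set s0 := input freq B L in F hF g g_perm g_sorted g_rank *.
apply: runs_seq.
apply: (runs_weaken (runs_agree (runs_sort_chars (n := n) (F := F) _ _))) => //.
move=> s1 [hrank hag1].
have h11 r : r < n -> nmem s1 11 [:: r] = g r.
  by move=> hr; rewrite -{1}(g_rank r hr) hrank.
apply: runs_seq.
apply: (runs_weaken (runs_agree (runs_tabulate_decode_times (n := n) (B := B) _ _ _ _ _ _ _ _)));
  try by rewrite ?hag1.1 ?hag1.2 // => *; rewrite ?hag1.1 ?hag1.2.
- by move=> d; apply: long_enough_width.
move=> s2 [hD hag2].
apply: runs_seq.
apply: (runs_weaken (runs_agree (runs_tabulate_products (n := n)
  (f := fun r => freq (g r)) _ _ _))) => //.
- by rewrite hag2.1 // hag1.1.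
- move=> r hr; rewrite !hag2.1 // h11 // hag1.1 //; exact: hF.
- by move=> x; rewrite hag2.1 // hag1.1.
move=> s3 [h16 hag3].
have hs3 : tables freq D n L g s3.
  split.
  - by rewrite hag3.1 // hag2.1 // hag1.1.
  - by rewrite hag3.1 // hag2.1 // hag1.1.
  - by move=> r hr; rewrite !hag3.1 // !hag2.1 // h11 // hag1.1 //; exact: hF.
  - exact: h16.
  - by move=> d hd; rewrite hag3.2 // hD.
apply: runs_seq.
apply: (runs_weaken (runs_agree (runs_fill_table hs3 _))); [|exact: leqnn|].
  by move=> x; rewrite /cell hag3.1 // hag3.2 // hag2.1 // hag2.2 // hag1.1 // hag1.2.
move=> s4 [hfill hag4].
have hs4 : tables freq D n L g s4 by apply: tables_agree (agree_sub _ _ hag4) hs3; apply/allP.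
have [t0 t1 t3 t16 tD] := hs4.
have h17 k r b l : k <= n -> r <= n -> b <= n -> l <= L ->
    nmem s4 17 [:: k; r; b; l] = (tab freq D n g k r b l).1.
  move=> hk hr hb hl; have := hfill k r b l.
  by rewrite ifT /cell => [<-|] //; rewrite /done; lia.
have h5 : nmem s4 5 [::] = 0.
  by rewrite hag4.1 // hag3.1 // hag2.1 // hag1.1.
apply: runs_leq (runs_if (T := 20 + (n + n).+1 * emit_cost n) _) _.
- rewrite /= t0 t1 h17 //; case: eqP => [hz|hnz].
    apply: runs_straightW => //; right; split=> //.
    exact: (tab_infeasible n_gt0 B_scheme g_perm g_sorted hz).
  have hpos : 0 < (tab freq D n g n n 1 L).1 by rewrite lt0n; apply/eqP.
  have [T eT hT] := tab_solution n_gt0 B_scheme g_perm g_sorted hpos.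
  apply: runs_seq; apply: runs_straightW => //; set s5 := run _ s4.
  apply: (runs_weaken (runs_agree (runs_emit_tree (k := n) (r := n) (b := 1) (l := L)
    (p := 0) (m := n + n) (freq := freq) (D := D) (L := L) (g := g) T _ _ _ _ _ _ hpos))) => //.
  + split=> // r hr; rewrite -h11 // -[LHS]/(nmem s4 11 [:: r]).
    by rewrite hag4.1 // hag3.1 // hag2.1.
  + split=> //; rewrite -[LHS]/(nmem s4 19 [::]).
    by rewrite hag4.1 // hag3.1 // hag2.1 // hag1.1.
  move=> s6 [[hst _] hag6]; left; split; first by rewrite hag6.1.
  exists T; split=> //; have := hst 0 isT; rewrite eT add0n /=.
  have -> // : nmem s6 out_root [::] = 0.
  rewrite hag6.1 // -[LHS]/(nmem s4 6 [::]).
  by rewrite hag4.1 // hag3.1 // hag2.1 // hag1.1.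
- by rewrite /=; lia.
Qed.
End Main.

(** * Running time *)

(** Peels off one loop of a nest: since [X > 0], the extra step per round is absorbed by raising [b]
    to [b.+1]. *)
Lemma loop_cost_le e N T a n b X :
  N <= a * n -> T <= b * X -> 0 < X ->
  e * (N * T.+1) <= (e * (a * b.+1)) * (n * X).
Proof.
move=> hN hT hX; rewrite -mulnA leq_mul2l; apply/orP; right.
by rewrite mulnACA; apply: leq_mul hN _; rewrite mulSn; lia.
Qed.

(** Three loops contribute a factor [n] each and the innermost one [maxn L 1]; the maximum is there
    because budget 0 still takes one column. *)
Lemma fill_table_cost_le : exists K, forall n L, 0 < n ->
  fill_table_cost n L <= K * (n ^ 3 * maxn L 1).
Proof.
set c := straight_cost fill_cell.
pose K1 := 15 * (3 * c.+1); pose K2 := 15 * (3 * K1.+1).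
pose K3 := 15 * (3 * K2.+1); exists (13 * (2 * K3.+1)) => n L n_gt0.
set M := maxn L 1; have hM : 0 < M by rewrite /M; lia.
have -> : n ^ 3 * M = n * (n * (n * (M * 1))) by rewrite !expnS expn0; lia.
have pos : [/\ 0 < M * 1, 0 < n * (M * 1) & 0 < n * (n * (M * 1))].
  by rewrite !muln_gt0 hM n_gt0.
have hL : L.+2 <= 3 * M by rewrite /M; lia.
have hn1 : n.+1 <= 2 * n by lia. have hn2 : n.+2 <= 3 * n by lia.
lazy delta [fill_table_cost] zeta; rewrite -/c.
case: pos => pos1 pos2 pos3.
by do 4!(apply: loop_cost_le => //); rewrite muln1.
Qed.

Lemma solve_cost_le : exists K, forall n L, 0 < n ->
  solve_cost n L <= K * (n ^ 3 * maxn L 1).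
Proof.
(* The constant [100 * 1000] generously covers the phases other than the table, which are at most
   quadratic in [n]. *)
have [K hK] := fill_table_cost_le; exists (100 * 1000 + K) => n L n_gt0.
have := hK n L n_gt0; rewrite /solve_cost /emit_cost.
have hM : 0 < maxn L 1 by lia.
set X := n ^ 3 * _.
have h2 : n * n <= X.
  have -> : X = n * maxn L 1 * (n * n) by rewrite /X !expnS expn0; lia.
  by rewrite leq_pmull // muln_gt0 n_gt0.
have h1 : n <= X by apply: leq_trans h2; rewrite leq_pmull.
move: (fill_table_cost n L) => t ht; rewrite mulnDl.
move: (K * X) ht => y hy; move: (X) h1 h2 => {hK K} x h1 h2.
nia.
Qed.

Theorem theorem1 (R : realDomainType) :
  exists (P : cmd) (K : nat),
  forall (n : nat) (freq : 'I_n -> nat) (B : seq (nat * R)) (L : nat),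
    0 < n -> blocking_scheme B -> long_enough 'I_n B ->
    exists (s : state R) (t : nat),
      [/\ exec P (input freq B L) s t,
          t <= K * (n ^ 3 * maxn L 1)
        & outputs_DOPT freq B L s].
Proof.
have [K hK] := solve_cost_le; exists solve_DOPT, K => n freq B L n_gt0 hB hlong.
by apply: runs_leq (runs_solve_DOPT freq L n_gt0 hB hlong) _; exact: hK.
Qed.
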